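(* Let $(K,v)$ be a valued field, extend $v$ to the algebraic closure $\tilde K$ of $K$, and let $K^h\subseteq\tilde K$ be the henselization of $(K,v)$ with respect to this extension. Let $z\in\tilde K\setminus K$ be such that \[ v(z-a)\;>\;v(a-K) \] for some $a\in K^h$. Then $K^h$ and $K(z)$ are not linearly disjoint over $K$, that is, \[ [K^h(z):K^h]<[K(z):K], \] and in particular, $K(z)|K$ is not purely inseparable.
   Context: Valuations are Krull valuations of arbitrary rank, written additively, with $v0=\infty$. The henselization $K^h$ is the decomposition field of $(K^{\mathrm{sep}}|K,v)$, i.e. the fixed field in the separable-algebraic closure $K^{\mathrm{sep}}\subseteq\tilde K$ of $\{\sigma\in \mathrm{Gal}(K^{\mathrm{sep}}|K) : v\circ\sigma=v \text{ on } K^{\mathrm{sep}}\}$. We put $v(a-K):=\{v(a-c)\mid c\in K\}$, and ''$\alpha>v(a-K)$'' means $\alpha>v(a-c)$ for all $c\in K$. *)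

(* Defs.v *)
From mathcomp Require Import all_boot all_order all_algebra all_field.
From mathcomp Require Import classical_sets functions.

Set Implicit Arguments.
Unset Strict Implicit.
Unset Printing Implicit Defensive.

Import Order.TTheory GRing.Theory Num.Theory.

Local Open Scope classical_set_scope.
Local Open Scope ring_scope.

(* Totally ordered abelian groups, of arbitrary rank; MathComp's porderZmodType
   relates its order and its addition by no axiom. *)
Record orderedAbGroupType := OrderedAbGroup {
  ordered_ab_group_sort :> porderZmodType;
  ordered_ab_group_total : forall x y : ordered_ab_group_sort,
    (x <= y) || (y <= x);
  ordered_ab_group_translate : forall z x y : ordered_ab_group_sort,
    x <= y -> z + x <= z + y
}.

(* Values are taken in [option G], where [None] stands for infinity and is
   larger than every element of G. *)
Section ExtendedValues.
Variable G : orderedAbGroupType.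
Implicit Types a b : option G.

Definition vle a b : bool :=
  match a, b with
  | _, None => true
  | None, Some _ => false
  | Some x, Some y => x <= y
  end.

Definition vlt a b : bool :=
  match a, b with
  | None, _ => false
  | Some _, None => true
  | Some x, Some y => x < y
  end.

Definition vmin a b : option G := if vle a b then a else b.

Definition vadd a b : option G :=
  match a, b with
  | Some x, Some y => Some (x + y)
  | _, _ => None
  end.

End ExtendedValues.

(* G only has to contain the value group: v need not be onto. *)
Record is_valuation (K : fieldType) (G : orderedAbGroupType)
    (v : K -> option G) : Prop := IsValuation {
  val_infty : forall x, v x = None <-> x = 0;
  valM : forall x y, v (x * y) = vadd (v x) (v y);
  valD : forall x y, vle (vmin (v x) (v y)) (v (x + y))
}.

(* The valuation w on L extends v along iota; the ordered group of w may be
   larger than that of v, which is embedded into it by j. *)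
Definition extends_valuation (K L : fieldType) (iota : K -> L)
    (G H : orderedAbGroupType) (v : K -> option G) (w : L -> option H) : Prop :=
  exists j : {additive G -> H},
    {mono j : x y / x <= y} /\ forall c, w (iota c) = omap j (v c).

(* The closedness of L is carried by its type. *)
Definition is_algebraic_closure (K : fieldType) (L : closedFieldType)
    (iota : {rmorphism K -> L}) : Prop :=
  forall x : L, algebraicOver iota x.

Section Subfields.
Variable L : fieldType.
Implicit Types (F E : set L) (z : L).

(* Since y^-1 = 0 for y = 0, no condition y != 0 is needed. *)
Definition is_subfield F : Prop :=
  [/\ F 1, forall x y, F x -> F y -> F (x - y)
         & forall x y, F x -> F y -> F (x / y)].

Definition adjoin F z : set L := smallest is_subfield (F `|` [set z]).

Definition lin_indep F (n : nat) (e : 'I_n -> L) : Prop :=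
  forall c : 'I_n -> L, (forall i, F (c i)) ->
    \sum_i c i * e i = 0 -> forall i, c i = 0.

Definition lin_span F E (n : nat) (e : 'I_n -> L) : Prop :=
  forall x, E x ->
    exists c : 'I_n -> L, (forall i, F (c i)) /\ x = \sum_i c i * e i.

(* [E : F] = n *)
Definition has_degree E F (n : nat) : Prop :=
  exists e : 'I_n -> L,
    [/\ forall i, E (e i), lin_indep F e & lin_span F E e].

Definition linearly_disjoint F E1 E2 : Prop :=
  forall (n : nat) (e : 'I_n -> L),
    (forall i, E1 (e i)) -> lin_indep F e -> lin_indep E2 e.

(* [pchar L].-nat n says that n is a power of the characteristic exponent:
   n = 1 in characteristic 0 and n = p ^ k in characteristic p. *)
Definition purely_inseparable_ext E F : Prop :=
  forall x, E x -> exists2 n : nat, [pchar L].-nat n & F (x ^+ n).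

(* Automorphisms of the subfield E that fix F pointwise, represented by maps
   L -> L whose values outside E are irrelevant. *)
Definition is_aut E F (s : L -> L) : Prop :=
  [/\ set_bij E E s,
      forall x y, E x -> E y -> s (x + y) = s x + s y,
      forall x y, E x -> E y -> s (x * y) = s x * s y
    & forall x, F x -> s x = x].

End Subfields.

Section Henselization.
Variables (K L : fieldType) (iota : {rmorphism K -> L}).

(* The monic irreducible polynomial p is the minimal polynomial of x. *)
Definition sep_closure : set L :=
  [set x | exists p : {poly K},
     [/\ p \is monic, irreducible_poly p, root (map_poly iota p) x
       & separable_poly p]].

Variables (H : orderedAbGroupType) (w : L -> option H).

Definition decomposition_group : set (L -> L) :=
  [set s | is_aut sep_closure (range iota) s
           /\ forall x, sep_closure x -> w (s x) = w x].

Definition henselization : set L :=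
  [set x | sep_closure x /\ forall s, decomposition_group s -> s x = x].

(* v(a - F) *)
Definition val_diffs (a : L) (F : set L) : set (option H) :=
  [set w (a - c) | c in F].

End Henselization.

(* Main.v *)
Require Import Defs.
From HB Require Import structures.
From mathcomp Require Import all_boot all_order all_algebra all_field.
From mathcomp Require Import boolp classical_sets functions.

(** Write v for the valuation on L, K^h for the henselization, and call x near
    to a when v(x - a) > v(a - K).

    The heart of the matter is [not_all_roots_near]: if a lies in K^h, then a
    nonconstant polynomial f over K cannot have all its roots near to a.  If n
    is the degree of f and n is a unit of the valuation ring, this is seen by
    averaging: the mean of the roots lies in K and is near to a, which is absurd
    since v(a - c) > v(a - c) holds for no c.  In general the conjugates a_i of
    a over K are averaged instead, with weights that are values at the a_i of
    one polynomial C over K.  The element c = (sum of C(a_i) a_i) / (sum of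
    C(a_i)) lies in K ([trace_in_base]), and a - c is the corresponding mean of
    the differences a - a_i.  So c is near to a, which is the same absurdity,
    as soon as C(a) = 1 up to elements of positive value while, for a_i <> a,
    C(a_i) has positive value and C(a_i) (a_i - a) has value above v(a - K).

    Such weights come from two ingredients.

    First, a is in K^h, so for a_i <> a the map Q(a) |-> v(Q(a_i)) is a
    valuation of K(a) other than v ([conjugate_isometry_eq]).  Otherwise the
    embedding of K(a) into L that sends a to a_i would preserve v, and then it
    would extend to an automorphism of L preserving v: [pi_total] obtains it by
    Zorn's lemma from the extension by one element in [conj_extension], and its
    restriction to the separable closure belongs to the decomposition group but
    moves a.  By weak approximation ([approx_separate]) there is then a b in
    K[X] with v(b(a) - 1) > 0 and v(b(a_i)) > 0 for a_i <> a.

    Secondly, f makes b as small as needed at those a_i that are not near to a.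
    Let z_1, ..., z_n be the roots of f.  As they are all near to a and a_i is
    not, f(a) has value v(z_1 - a) + ... + v(z_n - a), whereas f(a_i) has value
    n v(a_i - a).  The value group of L is torsion over that of K, hence some
    power f^m can be divided by an r in K with v(r) = m v(f(a)).  Then f^m / r is
    a unit at a, and at a_i its value is at most v(a_i - a) - v(z_1 - a).  So,
    for t = (1 - b) f^m / r, the factor 1 / (1 + t) leaves b unchanged at a up to
    elements of positive value and makes b(a_i) (a_i - a) at least as small as
    z_1 - a.  At the other conjugates 1 + t might have positive value; this is
    avoided by replacing 1 + t by another polynomial in t ([approx_one]).

    Now let f be the minimal polynomial of z over K.  If z is purely inseparable
    over K, then z is the only root of f, which is excluded.  If z has the same
    degree over K^h as over K, then f is its minimal polynomial over K^h, and all
    roots of f have the same distance from a: some power z^q is separable over K,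
    and the orbit of z^q under the decomposition group is the set of roots of a
    polynomial over K^h, which vanishes at the q-th power of every root of f
    ([orbit_polynomial], [conjugates_equidistant]).  Again this is excluded, so
    the degree drops; and it cannot drop when K^h and K(z) are linearly disjoint
    ([linearly_disjoint_degree_le]). *)

Import Order.TTheory GRing.Theory Num.Theory.
Local Open Scope classical_set_scope.
Local Open Scope ring_scope.

Set Implicit Arguments.
Unset Strict Implicit.
Unset Printing Implicit Defensive.

(** * The preorder on a field defined by a valuation *)

(** Comparing values by a relation on L itself, as if x divided y, keeps the
    value groups and infinity out of all later arguments. *)
Definition lev (L : fieldType) (H : orderedAbGroupType) (w : L -> option H)
  x y := vle (w x) (w y).
Definition ltv (L : fieldType) (H : orderedAbGroupType) (w : L -> option H)
  x y := vlt (w x) (w y).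

Local Notation "x '<=v[' w ']' y" := (lev w x y)
  (at level 70, w at level 50, y at next level).
Local Notation "x '<v[' w ']' y" := (ltv w x y)
  (at level 70, w at level 50, y at next level).

Section ValuationOrder.
Variables (L : fieldType) (H : orderedAbGroupType) (w : L -> option H).
Hypothesis hw : is_valuation w.
Implicit Types x y z t : L.

Lemma leg_add2l (c a b : H) : (c + a <= c + b) = (a <= b).
Proof.
apply/idP/idP => [h|]; last exact: ordered_ab_group_translate.
by rewrite -(addKr c a) -(addKr c b) ordered_ab_group_translate.
Qed.

Lemma ltgNge (a b : H) : (a < b) = ~~ (b <= a).
Proof.
have := ordered_ab_group_total a b; rewrite lt_neqAle.
case: (boolP (a <= b)) => hab /=; case: (boolP (b <= a)) => hba //= _.
- by rewrite andbT; apply/negbTE; rewrite negbK eq_le hab hba.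
- by rewrite andbT; apply: contra hba => /eqP ->.
by rewrite andbF.
Qed.

Lemma wval0 : w 0 = None.
Proof. exact/(val_infty hw). Qed.

Lemma levxx x : x <=v[w] x.
Proof. by rewrite /lev; case: (w x) => //= a; rewrite lexx. Qed.

Lemma lev_trans y x z : x <=v[w] y -> y <=v[w] z -> x <=v[w] z.
Proof.
rewrite /lev; case: (w x) => [a|]; case: (w y) => [b|]; case: (w z) => [c|] //=.
exact: le_trans.
Qed.

Lemma ltvNge x y : (x <v[w] y) = ~~ (y <=v[w] x).
Proof.
by rewrite /lev /ltv; case: (w x) => [a|]; case: (w y) => [b|] //=; rewrite ltgNge.
Qed.

Lemma levNgt x y : (x <=v[w] y) = ~~ (y <v[w] x).
Proof. by rewrite ltvNge negbK. Qed.

Lemma lev_total x y : (x <=v[w] y) || (y <=v[w] x).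
Proof.
by rewrite /lev; case: (w x) => [a|]; case: (w y) => [b|] //=;
   exact: ordered_ab_group_total.
Qed.

Lemma ltvW x y : x <v[w] y -> x <=v[w] y.
Proof. by rewrite ltvNge => h; case/orP: (lev_total x y) => // h'; rewrite h' in h. Qed.

Lemma lev_lt_trans y x z : x <=v[w] y -> y <v[w] z -> x <v[w] z.
Proof. by move=> h; rewrite !ltvNge; apply: contra => h'; exact: lev_trans h' h. Qed.

Lemma ltv_le_trans y x z : x <v[w] y -> y <=v[w] z -> x <v[w] z.
Proof. by move=> + h; rewrite !ltvNge; apply: contra => h'; exact: lev_trans h h'. Qed.

Lemma ltv_trans y x z : x <v[w] y -> y <v[w] z -> x <v[w] z.
Proof. by move=> /ltvW; exact: lev_lt_trans. Qed.

Lemma ltvxx x : x <v[w] x = false.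
Proof. by rewrite ltvNge levxx. Qed.

Lemma lev0 x : x <=v[w] 0.
Proof. by rewrite /lev wval0; case: (w x). Qed.

Lemma lev0E x : (0 <=v[w] x) = (x == 0).
Proof.
rewrite /lev wval0; apply/idP/eqP => [|->]; last by rewrite wval0.
by case e : (w x) => [a|] // _; apply/(val_infty hw).
Qed.

Lemma ltv0E x : (x <v[w] 0) = (x != 0).
Proof. by rewrite ltvNge lev0E. Qed.

Lemma ltv_neq0 x y : x <v[w] y -> x != 0.
Proof. by rewrite ltvNge; apply: contraNneq => ->; exact: lev0. Qed.

Lemma lev_neq0 x y : x <=v[w] y -> y != 0 -> x != 0.
Proof. by move=> h; apply: contra => /eqP x0; rewrite -lev0E -x0. Qed.

Lemma lev_mul2r t x y : x <=v[w] y -> x * t <=v[w] y * t.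
Proof.
rewrite /lev !(Defs.valM hw); case: (w x) => [a|]; case: (w y) => [b|];
  case: (w t) => [c|] //=.
by rewrite !(addrC _ c) leg_add2l.
Qed.

Lemma lev_pmul2r t x y : t != 0 -> (x * t <=v[w] y * t) = (x <=v[w] y).
Proof.
move=> t0; apply/idP/idP => [/(lev_mul2r t^-1)|]; last exact: lev_mul2r.
by rewrite !mulfK.
Qed.

Lemma ltv_pmul2r t x y : t != 0 -> (x * t <v[w] y * t) = (x <v[w] y).
Proof. by move=> t0; rewrite !ltvNge lev_pmul2r. Qed.

Lemma lev_pmul2l t x y : t != 0 -> (t * x <=v[w] t * y) = (x <=v[w] y).
Proof. by rewrite !(mulrC t); exact: lev_pmul2r. Qed.

Lemma ltv_pmul2l t x y : t != 0 -> (t * x <v[w] t * y) = (x <v[w] y).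
Proof. by rewrite !(mulrC t); exact: ltv_pmul2r. Qed.

Lemma lev_mul x y z t : x <=v[w] y -> z <=v[w] t -> x * z <=v[w] y * t.
Proof.
move=> h1 h2; apply: (@lev_trans (y * z)); first exact: lev_mul2r.
by rewrite !(mulrC y); exact: lev_mul2r.
Qed.

Lemma ltv_le_mul x y z t :
  x <v[w] y -> z <=v[w] t -> z != 0 -> x * z <v[w] y * t.
Proof.
move=> h1 h2 z0; apply: (@ltv_le_trans (y * z)); first by rewrite ltv_pmul2r.
by rewrite !(mulrC y); exact: lev_mul2r.
Qed.

Lemma lev1_mul x y : 1 <=v[w] x -> 1 <=v[w] y -> 1 <=v[w] x * y.
Proof. by move=> h1 h2; rewrite -[X in X <=v[_] _](mul1r 1); exact: lev_mul. Qed.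

Lemma ltv1_mull x y : 1 <v[w] x -> 1 <=v[w] y -> 1 <v[w] x * y.
Proof.
move=> h1 h2; rewrite -[X in X <v[_] _](mul1r 1).
by apply: ltv_le_mul; rewrite ?oner_eq0.
Qed.

Lemma ltv1_mulr x y : 1 <=v[w] x -> 1 <v[w] y -> 1 <v[w] x * y.
Proof. by move=> h1 h2; rewrite mulrC; exact: ltv1_mull. Qed.

Lemma lev_X n x y : x <=v[w] y -> x ^+ n <=v[w] y ^+ n.
Proof.
by move=> h; elim: n => [|n IH]; rewrite ?expr0 ?levxx // !exprS; exact: lev_mul.
Qed.

Lemma ltv_X n x y : (0 < n)%N -> x <v[w] y -> x ^+ n <v[w] y ^+ n.
Proof.
case: n => // n _ h; rewrite !exprS; apply: ltv_le_mul => //.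
  exact/lev_X/ltvW.
exact/expf_neq0/(ltv_neq0 h).
Qed.

Lemma lev_Xe n x y : (0 < n)%N -> (x ^+ n <=v[w] y ^+ n) = (x <=v[w] y).
Proof.
move=> n0; apply/idP/idP; last exact: lev_X.
by rewrite levNgt => h; rewrite levNgt; apply: contra h; exact: ltv_X.
Qed.

Lemma lev_inv x y : x != 0 -> y != 0 -> (x^-1 <=v[w] y^-1) = (y <=v[w] x).
Proof.
move=> x0 y0; rewrite -(@lev_pmul2r (x * y)) ?mulf_neq0 //.
by rewrite mulKf // [x * y]mulrC mulKf.
Qed.

Lemma ltv_inv x y : x != 0 -> y != 0 -> (x^-1 <v[w] y^-1) = (y <v[w] x).
Proof. by move=> x0 y0; rewrite !ltvNge lev_inv. Qed.

Lemma lev_add t x y : t <=v[w] x -> t <=v[w] y -> t <=v[w] x + y.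
Proof.
rewrite /lev => h1 h2; have := Defs.valD hw x y; rewrite /vmin.
set u := (if _ then _ else _) => h; have : vle (w t) u by rewrite /u; case: ifP.
move: h; case: u => [a|]; case: (w (x + y)) => [b|]; case: (w t) => [c|] //=.
by move=> ? ?; apply: le_trans; eassumption.
Qed.

Lemma lev_N1_1 : -1 <=v[w] 1.
Proof.
case/orP: (lev_total (-1) 1) => // h.
by have := lev_mul2r (-1) h; rewrite mul1r mulrNN mulr1.
Qed.

(** Only -1 needs an argument: 1 and -1 are comparable, and multiplying by -1
    reverses the comparison. *)
Lemma wvalN x : w (- x) = w x.
Proof.
have h y : - y <=v[w] y.
  by have := lev_mul2r y lev_N1_1; rewrite mulN1r mul1r.
move: (h x) (h (- x)); rewrite /lev opprK.
by case: (w x) => [a|]; case: (w (- x)) => [b|] //= h1 h2; congr Some;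
   apply: le_anti; rewrite h1 h2.
Qed.

Lemma levNr t x : (t <=v[w] - x) = (t <=v[w] x).
Proof. by rewrite /lev wvalN. Qed.
Lemma ltvNr t x : (t <v[w] - x) = (t <v[w] x).
Proof. by rewrite /ltv wvalN. Qed.
Lemma ltv_distrC t x y : (t <v[w] x - y) = (t <v[w] y - x).
Proof. by rewrite -ltvNr opprB. Qed.

Lemma weqP x y : reflect (w x = w y) ((x <=v[w] y) && (y <=v[w] x)).
Proof.
apply: (iffP andP) => [[]|]; last first.
  by rewrite /lev => ->; rewrite -/(lev w y y) levxx.
rewrite /lev; case: (w x) => [a|]; case: (w y) => [b|] //= h1 h2.
by congr Some; apply: le_anti; rewrite h1 h2.
Qed.

Lemma ltv_add t x y : t <v[w] x -> t <v[w] y -> t <v[w] x + y.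
Proof.
move=> h1 h2; rewrite ltvNge; apply/negP => h.
have [hxy|hyx] := orP (lev_total x y).
  have : x <=v[w] x + y by apply: lev_add => //; exact: levxx.
  by move=> /lev_trans /(_ h); rewrite levNgt h1.
have : y <=v[w] x + y by apply: lev_add => //; exact: levxx.
by move=> /lev_trans /(_ h); rewrite levNgt h2.
Qed.

Lemma ltv_sum (I : Type) (r : seq I) (P : pred I) (F : I -> L) t :
  t != 0 -> (forall i, P i -> t <v[w] F i) -> t <v[w] \sum_(i <- r | P i) F i.
Proof.
move=> t0 h; elim/big_rec: _ => [|i x Pi hx]; first by rewrite ltv0E.
exact/ltv_add/hx/h.
Qed.

(** In a sum of two terms of different values, the smaller value wins. *)
Lemma wvalDl x y : x <v[w] y -> w (x + y) = w x.
Proof.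
move=> h; apply/weqP/andP; split; last first.
  by apply: lev_add; [exact: levxx|exact: ltvW].
rewrite levNgt; apply/negP => h'.
have : x <v[w] x + y - y by apply: ltv_add; rewrite ?ltvNr.
by rewrite addrK ltvxx.
Qed.

Lemma wvalBl x y : x <v[w] y -> w (x - y) = w x.
Proof. by move=> h; rewrite wvalDl // ltvNr. Qed.

Lemma wval_near1 x : 1 <v[w] x - 1 -> w x = w 1.
Proof. by move=> h; rewrite -[x](subrK 1) addrC wvalDl. Qed.

Lemma wvalM x y x' y' : w x = w x' -> w y = w y' -> w (x * y) = w (x' * y').
Proof. by move=> h1 h2; rewrite !(Defs.valM hw) h1 h2. Qed.

Lemma wvalX n x y : w x = w y -> w (x ^+ n) = w (y ^+ n).
Proof. by move=> h; elim: n => // n IH; rewrite !exprS; exact: wvalM. Qed.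

Lemma wval_eq0 x y : w x = w y -> (x == 0) = (y == 0).
Proof. by move=> h; rewrite -!lev0E /lev h. Qed.

Lemma wval_mul1l x y : w x = w 1 -> w (x * y) = w y.
Proof. by move=> h; rewrite -[in RHS](mul1r y); exact: wvalM. Qed.

End ValuationOrder.

(** * Weak approximation for finitely many valuations *)

Section Sylvester.
Variable R : comNzRingType.
(** Sylvester's recursion u_k = 1 + u * u_0 * ... * u_(k-1).  Any two of the
    u_k generate the unit ideal, so a valuation that is nonnegative at u is
    positive at no more than one of them. *)
Definition sylvester_prod (u : R) k := iter k (fun p => p * (1 + u * p)) 1.
Definition sylvester (u : R) k := 1 + u * sylvester_prod u k.
Lemma sylvester_prodS u k :
  sylvester_prod u k.+1 = sylvester_prod u k * sylvester u k.
Proof. by []. Qed.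
End Sylvester.

Lemma rmorph_sylvester (R S : comNzRingType) (g : {rmorphism R -> S}) u k :
  g (sylvester u k) = sylvester (g u) k.
Proof.
have h : g (sylvester_prod u k) = sylvester_prod (g u) k.
  by elim: k => [|k IH]; rewrite ?rmorph1 //= rmorphM rmorphD rmorphM rmorph1 IH.
by rewrite /sylvester rmorphD rmorphM rmorph1 h.
Qed.

Section Approximation.
Variables (L : fieldType) (H : orderedAbGroupType) (w : L -> option H).
Hypothesis hw : is_valuation w.
Implicit Types x y z t : L.

Lemma sylvester_prod_int x k : 1 <=v[w] x -> 1 <=v[w] sylvester_prod x k.
Proof.
move=> x1; elim: k => [|k IH]; first exact: levxx.
rewrite sylvester_prodS; apply: (lev1_mul hw) => //.
by apply: (lev_add hw); [exact: levxx|exact: (lev1_mul hw)].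
Qed.

Lemma sylvester_pos x k : 1 <v[w] x -> 1 <v[w] sylvester x k - 1.
Proof.
move=> x1; rewrite /sylvester addrC addKr.
by apply: (ltv1_mull hw) => //; apply/sylvester_prod_int/ltvW.
Qed.

Lemma sylvester_neg x k : x <v[w] 1 -> sylvester x k <=v[w] x.
Proof.
move=> x1.
have step p : p <=v[w] 1 -> 1 + x * p <=v[w] x.
  move=> p1; have xp : x * p <=v[w] x.
    by rewrite -[X in _ <=v[_] X](mulr1 x); apply: (lev_mul hw) => //; exact: levxx.
  have h := wvalDl hw (lev_lt_trans xp x1).
  by rewrite addrC /lev h.
apply: (step _ _); elim: k => [|k IH]; first exact: levxx.
rewrite sylvester_prodS -[X in _ <=v[_] X](mul1r 1); apply: (lev_mul hw) => //.
exact/(lev_trans (step _ IH))/ltvW.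
Qed.

(** For i < j the product in the recursion for the j-th term contains the i-th
    term. *)
Lemma sylvester_comax x i j : 1 <=v[w] x -> (i < j)%N ->
  1 <v[w] sylvester x i -> sylvester x j <=v[w] 1.
Proof.
move=> x1 ij hi.
have hp : 1 <v[w] sylvester_prod x j.
  elim: j ij => // j IH; rewrite ltnS leq_eqVlt => /orP[/eqP<-|/IH h];
    rewrite sylvester_prodS.
    by apply: (ltv1_mulr hw) => //; exact: sylvester_prod_int.
  apply: (ltv1_mull hw) => //; apply: (lev_add hw); first exact: levxx.
  exact/(lev1_mul hw)/ltvW.
have h : 1 <v[w] sylvester x j - 1.
  by rewrite /sylvester addrC addKr; exact: (ltv1_mulr hw).
by rewrite /lev (wval_near1 hw h) -/(lev w 1 1) levxx.
Qed.

Variables (R : comNzRingType) (I : finType) (ev : I -> {rmorphism R -> L}).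
Hypothesis ev_inv : forall a, (forall i, ev i a != 0) ->
  exists b, forall i, ev i b * ev i a = 1.

(** Pigeonhole: each valuation of the family forbids at most one index. *)
Lemma sylvester_choice u :
  exists k, forall i, sylvester (ev i u) k <=v[w] 1.
Proof.
suff [k hk] : exists k : 'I_#|I|.+1, [forall i, sylvester (ev i u) k <=v[w] 1].
  by exists k => i; move/forallP: hk.
apply/existsP; rewrite -[X in is_true X]negbK negb_exists; apply/negP => /forallP h.
have {}h (k : 'I_#|I|.+1) : exists i, ~~ (sylvester (ev i u) k <=v[w] 1).
  by apply/existsP; rewrite -negb_forall.
pose f k := xchoose (h k).
have fP k : 1 <v[w] sylvester (ev (f k) u) k.
  by rewrite ltvNge; exact: (xchooseP (h k)).
have fint k : 1 <=v[w] ev (f k) u.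
  rewrite levNgt; apply/negP => h1.
  have := ltv_trans (fP k) (lev_lt_trans (sylvester_neg k h1) h1).
  by rewrite ltvxx.
have f_inj : injective f.
  have aux (k l : 'I_#|I|.+1) : f k = f l -> (k < l)%N -> False.
    move=> e kl; have := sylvester_comax (fint k) kl (fP k).
    by rewrite e levNgt fP.
  move=> k l e; apply: val_inj => /=; case: (ltngtP k l) => // kl.
    by case: (aux _ _ e kl).
  by case: (aux _ _ (esym e) kl).
by have := leq_card _ f_inj; rewrite card_ord ltnn.
Qed.

(** The element c plays the role of 1 / (1 + u): it is close to 1 where u is
    small and its value is at least that of 1 / u where u is large.  For 1 / (1 + u)
    itself, c might fail to be integral at a valuation where u is close to -1;
    a later term of Sylvester's recursion takes the place of 1 + u. *)
Lemma approx_one u : exists c, forall i,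
  [/\ 1 <=v[w] ev i c,
      1 <v[w] ev i u -> 1 <v[w] ev i c - 1
    & ev i u <v[w] 1 -> 1 <=v[w] ev i c * ev i u].
Proof.
have [k hk] := sylvester_choice u.
have nz i : ev i (sylvester u k) != 0.
  by rewrite rmorph_sylvester; apply: (lev_neq0 hw (hk i)); rewrite oner_eq0.
have [c hc] := ev_inv nz; exists c => i.
have c0 : ev i c != 0.
  by apply/eqP => e; move: (hc i); rewrite e mul0r => /esym/eqP; rewrite oner_eq0.
move: (hc i) (hk i) (nz i); rewrite rmorph_sylvester.
set s := sylvester _ _ => cs s1 s0.
have lc x : (x <=v[w] ev i c) = (x * s <=v[w] 1).
  by rewrite -(lev_pmul2r hw _ _ s0) cs.
split.
- by rewrite lc mul1r.
- move=> u1; have ps := sylvester_pos k u1.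
  rewrite -(ltv_pmul2r hw _ _ s0) mul1r mulrBl cs mul1r (ltv_distrC hw).
  exact: lev_lt_trans s1 ps.
move=> u1; rewrite -(lev_pmul2r hw _ _ s0) mul1r mulrAC cs mul1r.
exact: sylvester_neg.
Qed.

(** The product, over the other indices, of the elements that [approx_one]
    attaches to the separating elements u. *)
Lemma approx_separate i0 :
  (forall i, i != i0 -> exists u, 1 <v[w] ev i0 u /\ ev i u <v[w] 1) ->
  exists b, 1 <v[w] ev i0 b - 1 /\ forall i, i != i0 -> 1 <v[w] ev i b.
Proof.
move=> hsep.
suff [b [b0 _ hb]] : exists b, [/\ 1 <v[w] ev i0 b - 1, forall i, 1 <=v[w] ev i b
    & forall i, i \in enum I -> i != i0 -> 1 <v[w] ev i b].
  by exists b; split => // i; apply: hb; rewrite mem_enum.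
elim: (enum I) => [|j s [b [b0 b1 hb]]].
  exists 1; split => // [|i]; rewrite rmorph1; last exact: levxx.
  by rewrite subrr (ltv0E hw) oner_eq0.
have [ji0|ji0] := eqVneq j i0.
  exists b; split => // i; rewrite inE => /orP[/eqP->|]; last exact: hb.
  by rewrite ji0 eqxx.
have [u [u0 uj]] := hsep j ji0.
have [c hc] := approx_one u.
exists (b * c); split.
- have [ci0 /(_ u0) ci0' _] := hc i0.
  rewrite rmorphM.
  have -> : ev i0 b * ev i0 c - 1 = (ev i0 b - 1) * ev i0 c + (ev i0 c - 1).
    by rewrite mulrBl mul1r addrA subrK.
  apply: (ltv_add hw) => //.
  exact: (ltv1_mull hw).
- move=> i; have [ci _ _] := hc i.
  by rewrite rmorphM; exact: (lev1_mul hw).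
move=> i; rewrite inE => /orP[/eqP->|si] ii0; rewrite rmorphM; last first.
  have [ci _ _] := hc i.
  by apply: (ltv1_mull hw) => //; exact: hb.
have [_ _ /(_ uj) cj] := hc j.
have cj1 : 1 <v[w] ev j c.
  have [->|c0] := eqVneq (ev j c) 0; first by rewrite (ltv0E hw) oner_eq0.
  by apply: (lev_lt_trans cj); rewrite -[X in _ <v[_] X]mulr1 (ltv_pmul2l hw).
exact: (ltv1_mulr hw).
Qed.

End Approximation.

(** * Values of polynomials at algebraic elements *)

Section Evaluation.
Variables (F : fieldType) (L : fieldType).
Implicit Types (p : {rmorphism F -> L}) (q Q : {poly F}).

(** Evaluation at y is packaged as a ring morphism from {poly F}: weak
    approximation can then be done in F[X], and no extension field of F with its
    embeddings into L has to be constructed. *)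
Definition evalp p (y : L) : {rmorphism {poly F} -> L} :=
  [the {rmorphism {poly F} -> L} of horner_eval y \o map_poly p].

Arguments evalp : simpl never.

Lemma evalpE p y Q : evalp p y Q = (map_poly p Q).[y].
Proof. by []. Qed.

Lemma evalpC p y c : evalp p y c%:P = p c.
Proof. by rewrite evalpE map_polyC hornerC. Qed.

Lemma evalpX p y : evalp p y 'X = y.
Proof. by rewrite evalpE map_polyX hornerX. Qed.

Lemma evalp_root p q y : root (map_poly p q) y = (evalp p y q == 0).
Proof. by []. Qed.

Lemma evalp_dvd p q Q y : q %| Q -> root (map_poly p q) y -> evalp p y Q = 0.
Proof.
move=> /dvdpP[s ->]; rewrite evalp_root => /eqP e.
by rewrite rmorphM e mulr0.
Qed.

(** A polynomial of least size among those vanishing at x, made monic. *)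
Lemma minpoly_exists p x : algebraicOver p x ->
  exists q, [/\ q \is monic, irreducible_poly q, root (map_poly p q) x
    & forall Q, evalp p x Q = 0 -> q %| Q].
Proof.
move=> [q0 q0n0 q0x].
pose P n := `[< exists q, [/\ q != 0, evalp p x q = 0 & size q = n] >].
have exP : exists n, P n by exists (size q0); apply/asboolP; exists q0; split=> //; apply/eqP.
case: (ex_minnP exP) => n /asboolP[q1 [q1n0 q1x sq1]] min.
pose q := (lead_coef q1)^-1 *: q1.
have lc0 : (lead_coef q1)^-1 != 0 by rewrite invr_eq0 lead_coef_eq0.
have qm : q \is monic by rewrite monicE lead_coefZ mulVf // lead_coef_eq0.
have qx : evalp p x q = 0 by rewrite /q -mul_polyC rmorphM q1x mulr0.
have sq : size q = n by rewrite size_scale.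
have qdvd Q : evalp p x Q = 0 -> q %| Q.
  move=> Qx; rewrite /dvdp; apply/negPn/negP => rn0.
  have rx : evalp p x (Q %% q) = 0.
    have := congr1 (evalp p x) (divp_eq Q q).
    by rewrite rmorphD rmorphM qx mulr0 add0r Qx.
  have := min (size (Q %% q)); rewrite leqNgt -sq ltn_modp (monic_neq0 qm) => h.
  have /h // : P (size (Q %% q)) by apply/asboolP; exists (Q %% q).
exists q; split => //; last exact/eqP.
split.
  rewrite ltnNge; apply/negP => /size1_polyC qC; move: qx (monic_neq0 qm).
  by rewrite qC evalpC polyC_eq0 => /eqP; rewrite fmorph_eq0 => ->.
move=> r r1 rq; apply/eqpP; move/dvdpP: (rq) => [s es].
have := congr1 (evalp p x) es; rewrite qx rmorphM => /esym/eqP.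
have /norP[sn0 rn0] : ~~ ((s == 0) || (r == 0)).
  by rewrite -mulf_eq0 -es monic_neq0.
rewrite mulf_eq0 => /orP[]/eqP/qdvd; last first.
  by move=> qr; apply/eqpP; rewrite /eqp rq qr.
move=> /(dvdp_leq sn0); rewrite es size_mul // => le.
suff sr : (size r <= 1)%N by case/negP: r1; rewrite eqn_leq sr lt0n size_poly_eq0 rn0.
move: le; case: (size r) => [|[|k]] //.
by rewrite addnS /= addnS -[X in (_ <= X)%N]addn0 ltn_add2l ltn0.
Qed.

Lemma irred_coprime_root p q Q y : irreducible_poly q ->
  root (map_poly p q) y -> evalp p y Q != 0 -> coprimep q Q.
Proof.
move=> qi qy Qy; rewrite irreducible_poly_coprime //.
by apply: contra Qy => qQ; rewrite (evalp_dvd qQ qy).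
Qed.

End Evaluation.

(** All the evaluations factor through the field F[X]/(q), so an element that
    does not vanish under one of them is inverted by the same Q' under all.  The
    morphisms p i may differ: they stand for several embeddings of F. *)
Lemma evalp_inv (F L : fieldType) (I : Type) (i0 : I)
    (p : I -> {rmorphism F -> L}) (y : I -> L) (q Q : {poly F}) :
  irreducible_poly q -> (forall i, root (map_poly (p i) q) (y i)) ->
  evalp (p i0) (y i0) Q != 0 ->
  exists Q', forall i, evalp (p i) (y i) Q' * evalp (p i) (y i) Q = 1.
Proof.
move=> qi qy /(irred_coprime_root qi (qy i0)) /Bezout_eq1_coprimepP[[u v] /= e].
exists v => i; have := congr1 (evalp (p i) (y i)) e.
by rewrite rmorphD !rmorphM rmorph1 (evalp_dvd (dvdpp q) (qy i)) mulr0 add0r.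
Qed.

Lemma poly_over_range (F L : fieldType) (p : {rmorphism F -> L}) (Q : {poly L}) :
  (forall i, range p Q`_i) -> exists P, map_poly p P = Q.
Proof.
move=> h; pose c i := xget 0 [set t | p t = Q`_i].
have cP i : p (c i) = Q`_i.
  by rewrite /c; case: xgetP => [t -> //|]; have [t _ e] := h i; move=> /(_ t).
exists (\poly_(i < size Q) c i); apply/polyP => i.
rewrite coef_map coef_poly; case: ltnP => [_|le]; first exact: cP.
by rewrite raddf0 nth_default.
Qed.

Section CharPoly.
Variables (F : fieldType) (b q : {poly F}).
Hypotheses (qm : q \is monic) (q1 : (1 < size q)%N).

Lemma matrix_of_monic : exists n (A : 'M[F]_n.+1), char_poly A = q.
Proof.
have := companionmxK qm; move: (companionmx q).
case e : (size q).-1 => [|n] A eA; first by case: (size q) q1 e => [|[]].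
by exists n; exists A.
Qed.

(** X is the characteristic polynomial of multiplication by b in F[X]/(q).  It
    does not depend on p, so it compares the values of b at the roots of q under
    different embeddings of F. *)
Lemma root_transform : exists2 X : {poly F}, X \is monic &
  forall (L : closedFieldType) (p : {rmorphism F -> L}),
    (forall x, root (map_poly p q) x -> root (map_poly p X) (evalp p x b)) /\
    (forall m, root (map_poly p X) m ->
       exists2 y, root (map_poly p q) y & m = evalp p y b).
Proof.
have [n [A eA]] := matrix_of_monic.
exists (char_poly (horner_mx A b)); first exact: char_poly_monic.
move=> L p; rewrite -eA !map_char_poly map_horner_mx.
set A' := map_mx p A; set b' := map_poly p b.
split=> [x|m]; rewrite -!eigenvalue_root_char.
  move=> /eigenvalueP[v ev v0]; apply/eigenvalueP; exists v => //.
  rewrite evalpE -/b'; elim/poly_ind: b' => [|P c IH].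
    by rewrite rmorph0 mulmx0 horner0 scale0r.
  rewrite rmorphD rmorphM /= horner_mx_X horner_mx_C !hornerE mulmxDr.
  rewrite -mulmxE mulmxA IH -scalemxAl ev scalerA mul_mx_scalar -scalerDl.
  by [].
move=> /eigenvalueP[v ev v0].
pose q' := char_poly A'; pose d := b' - m%:P.
have vd : v *m horner_mx A' d = 0.
  by rewrite rmorphB /= horner_mx_C mulmxBr ev mul_mx_scalar subrr.
have : ~~ coprimep q' d.
  apply/negP => /Bezout_eq1_coprimepP[[s t] /= e].
  have := congr1 (horner_mx A') e.
  rewrite rmorphD !rmorphM rmorph1 /= Cayley_Hamilton mulr0 add0r.
  rewrite (comm_horner_mx2 A' t d) => {}e.
  by move: v0; rewrite -[v]mulmx1 -[1%:M]e -mulmxE mulmxA vd mul0mx eqxx.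
rewrite coprimep_def => /closed_rootP[y]; rewrite root_gcd => /andP[q'y].
rewrite rootE hornerD hornerN hornerC subr_eq0 => /eqP dy.
by exists y => //; rewrite eigenvalue_root_char.
Qed.

End CharPoly.

(** * Extending a valuation-preserving embedding by one element *)

Section Torsion.
Variables (L : fieldType) (H : orderedAbGroupType) (w : L -> option H).
Hypothesis hw : is_valuation w.

Lemma wval_sum_distinct (I : eqType) (s : seq I) (f : I -> L) :
  uniq s ->
  {in s &, forall i j, i != j -> f i != 0 -> w (f i) <> w (f j)} ->
  (exists2 i, i \in s & f i != 0) ->
  exists i, [/\ i \in s, f i != 0 & w (\sum_(j <- s) f j) = w (f i)].
Proof.
elim: s => [|a s IH] /=; first by move=> _ _ [].
move=> /andP[a_s us] hd hex; rewrite big_cons.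
have hd' : {in s &, forall i j, i != j -> f i != 0 -> w (f i) <> w (f j)}.
  by move=> i j si sj; apply: hd; rewrite inE ?si ?sj orbT.
have [[i si fi]|none] := pselect (exists2 i, i \in s & f i != 0); last first.
  have fs i : i \in s -> f i = 0.
    by move=> si; apply/eqP/negPn/negP => h; apply: none; exists i.
  exists a; rewrite mem_head; split => //.
    have [j] := hex; rewrite inE => /orP[/eqP->//|/fs->]; by rewrite eqxx.
  by rewrite big_seq big1 ?addr0.
have [j [sj fj ej]] := IH us hd' (ex_intro2 _ _ i si fi).
have [fa|fa] := eqVneq (f a) 0.
  by exists j; rewrite inE sj orbT; split=> //; rewrite fa add0r.
have aj : a != j by apply: contraNneq a_s => ->.
have ne : w (f a) <> w (f j) by apply: hd; rewrite ?mem_head // inE sj orbT.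
have [h|h] := boolP (f a <v[w] f j).
  by exists a; rewrite mem_head; split=> //; rewrite wvalDl // /ltv ej.
exists j; rewrite inE sj orbT; split=> //; rewrite addrC wvalDl //.
rewrite -levNgt in h; rewrite /ltv ej -/(ltv w (f j) (f a)) ltvNge; apply/negP => h'.
by apply: ne; apply/weqP; rewrite h h'.
Qed.

(** The value group of an algebraic extension is torsion over that of the base:
    a sum of terms with pairwise distinct values does not vanish, so a polynomial
    equation for t has two terms c_i t^i and c_j t^j of the same value. *)
Lemma wval_torsion (F : fieldType) (p : {rmorphism F -> L}) t :
  algebraicOver p t -> t != 0 ->
  exists m r, [/\ (0 < m)%N, r != 0 & w (t ^+ m) = w (p r)].
Proof.
move=> [P Pn0]; rewrite rootE horner_coef size_map_poly => Pt t0.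
pose f i := (map_poly p P)`_i * t ^+ i.
have fE i : f i = p P`_i * t ^+ i by rewrite /f coef_map.
have nz i : (f i != 0) = (P`_i != 0).
  by rewrite fE mulf_eq0 expf_eq0 (negPf t0) andbF orbF fmorph_eq0.
have sum0 : \sum_(i <- iota 0 (size P)) f i = 0.
  by move/eqP: Pt; rewrite -(big_mkord xpredT f) /index_iota subn0.
have lift i j : (i < j)%N -> f i != 0 -> w (f i) = w (f j) ->
    exists m r, [/\ (0 < m)%N, r != 0 & w (t ^+ m) = w (p r)].
  move=> ij fi0 e; have fj0 : f j != 0 by rewrite -(wval_eq0 hw e).
  exists (j - i)%N, (P`_i / P`_j); rewrite subn_gt0 ij.
  rewrite nz in fi0; rewrite nz in fj0.
  rewrite mulf_neq0 ?invr_eq0 //; split => //.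
  have h := wvalM hw e (erefl (w ((p P`_j * t ^+ i)^-1))).
  have tn k : t ^+ k != 0 by rewrite expf_neq0.
  have pj : p P`_j != 0 by rewrite fmorph_eq0.
  suff [<- <-] : f i / (p P`_j * t ^+ i) = p (P`_i / P`_j) /\
    f j / (p P`_j * t ^+ i) = t ^+ (j - i) by [].
  rewrite !fE fmorph_div; split; first by rewrite -mulf_div divff ?mulr1.
  by rewrite -mulf_div divff // mul1r -exprB ?unitfE // ltnW.
apply: contrapT => none.
have [||i [_ fi e]] := @wval_sum_distinct _ (iota 0 (size P)) f (iota_uniq _ _).
- move=> i j _ _ ij fi e; apply: none.
  case: (ltngtP i j) => [lt|lt|eq]; last by rewrite eq eqxx in ij.
    exact: lift lt fi e.
  by apply: (lift _ _ lt _ (esym e)); rewrite -(wval_eq0 hw e).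
- exists (size P).-1; first by rewrite mem_iota /= add0n prednK ?size_poly_gt0.
  by rewrite nz -lead_coefE lead_coef_eq0.
by move: fi; rewrite -(wval_eq0 hw e) sum0 eqxx.
Qed.

Lemma coef_prod_XsubC_small (r : seq L) : (forall z, z \in r -> 1 <v[w] z) ->
  forall i, (i < size r)%N -> 1 <v[w] (\prod_(z <- r) ('X - z%:P))`_i.
Proof.
elim: r => [|z r IH] hr i //=; rewrite ltnS => ir.
rewrite big_cons; set P := \prod_(_ <- _) _.
have {}IH : forall i, (i < size r)%N -> 1 <v[w] P`_i.
  by apply: IH => u ur; apply: hr; rewrite inE ur orbT.
have P1 : 1 <=v[w] P`_i.
  move: ir; rewrite leq_eqVlt => /orP[/eqP->|/IH/ltvW//].
  suff -> : P`_(size r) = 1 by exact: levxx.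
  have := monic_prod_XsubC r predT id; rewrite -/P monicE lead_coefE.
  by rewrite size_prod_XsubC => /eqP.
rewrite mulrBl coefB coefXM mul_polyC coefZ; apply: (ltv_add hw).
  case: i ir {P1} => [|i] ir /=; first by rewrite (ltv0E hw) oner_eq0.
  exact: IH.
by rewrite (ltvNr hw); apply: (ltv1_mull hw) => //; apply: hr; rewrite mem_head.
Qed.

End Torsion.

Section ConjugateExtension.
Variables (F : fieldType) (L : closedFieldType) (p1 p2 : {rmorphism F -> L}).
Variables (H : orderedAbGroupType) (w : L -> option H).
Hypothesis hw : is_valuation w.
Hypothesis p12 : forall c, w (p1 c) = w (p2 c).
Hypothesis alg1 : forall x, algebraicOver p1 x.
Hypothesis alg2 : forall x, algebraicOver p2 x.

(** If Q has values A and B at x and y with v(A) > v(B), then A^M and B^M have the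
    values of constants s1 and s2 for some M > 0, and Q^(2M) / (s1 s2) has the
    value of (A / B)^M at x and of (B / A)^M at y. *)
Lemma separating_element q x y Q : irreducible_poly q ->
  root (map_poly p1 q) x -> root (map_poly p2 q) y ->
  w (evalp p1 x Q) <> w (evalp p2 y Q) ->
  exists u, 1 <v[w] evalp p1 x u /\ evalp p2 y u <v[w] 1.
Proof.
move=> qi qx qy.
pose pp (b : bool) := if b then p1 else p2.
pose yy (b : bool) := if b then x else y.
have qq b : root (map_poly (pp b) q) (yy b) by case: b.
(* The two values are exchanged by inverting Q modulo q. *)
wlog : Q / evalp p2 y Q <v[w] evalp p1 x Q.
  move=> wl ne; case: (boolP (evalp p2 y Q <v[w] evalp p1 x Q)) => [|nlt].
    by move=> /wl; apply.
  rewrite -levNgt in nlt.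
  have lt : evalp p1 x Q <v[w] evalp p2 y Q.
    by rewrite ltvNge; apply/negP => h; apply: ne; apply/weqP; rewrite nlt h.
  have A0 : evalp p1 x Q != 0 := ltv_neq0 hw lt.
  have [Q' hQ'] := @evalp_inv F L bool true pp yy q Q qi qq A0.
  have e1 : evalp p1 x Q' = (evalp p1 x Q)^-1.
    by apply: (mulIf A0); rewrite mulVf // (hQ' true).
  have B0 : evalp p2 y Q != 0.
    by apply: contra_neq (oner_neq0 L) => B0; rewrite -(hQ' false) [evalp (pp false) _ Q]B0 mulr0.
  have e2 : evalp p2 y Q' = (evalp p2 y Q)^-1.
    by apply: (mulIf B0); rewrite mulVf // (hQ' false).
  have h : evalp p2 y Q' <v[w] evalp p1 x Q' by rewrite e1 e2 (ltv_inv hw).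
  by apply: (wl Q' h) => e; move: h; rewrite /ltv e -/(ltv w _ _) ltvxx.
move=> lt _; set A := evalp p1 x Q in lt; set B := evalp p2 y Q in lt.
have B0 : B != 0 := ltv_neq0 hw lt.
have A0 : A != 0.
  have [Q' hQ'] := @evalp_inv F L bool false pp yy q Q qi qq B0.
  by apply: contra_neq (oner_neq0 L) => e; rewrite -(hQ' true) [evalp (pp true) _ Q]e mulr0.
have [m1 [r1 [m10 r10 e1]]] := wval_torsion hw (alg1 A) A0.
have [m2 [r2 [m20 r20 e2]]] := wval_torsion hw (alg2 B) B0.
pose M := (m1 * m2)%N; have M0 : (0 < M)%N by rewrite muln_gt0 m10.
pose s1 := r1 ^+ m2; pose s2 := r2 ^+ m1.
have E1 : w (A ^+ M) = w (p1 s1) by rewrite exprM rmorphXn; exact: wvalX.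
have E2 : w (B ^+ M) = w (p2 s2).
  by rewrite /M mulnC exprM rmorphXn; exact: wvalX.
have s0 : s1 * s2 != 0 by rewrite mulf_neq0 // expf_neq0.
exists ((Q ^+ (M + M)) * ((s1 * s2)^-1)%:P).
rewrite !rmorphM !rmorphXn !evalpC -/A -/B.
have lt' : B ^+ M <v[w] A ^+ M by exact: (ltv_X hw).
have An : A ^+ M != 0 by rewrite expf_neq0.
have Bn : B ^+ M != 0 by rewrite expf_neq0.
have n1 : p1 (s1 * s2) != 0 by rewrite fmorph_eq0.
have n2 : p2 (s1 * s2) != 0 by rewrite fmorph_eq0.
have W1 : w (p1 (s1 * s2)) = w (A ^+ M * B ^+ M).
  by rewrite rmorphM; apply: (wvalM hw); [rewrite E1|rewrite E2 p12].
have W2 : w (p2 (s1 * s2)) = w (A ^+ M * B ^+ M) by rewrite -p12.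
rewrite !fmorphV; split.
  rewrite -(ltv_pmul2r hw _ _ n1) mul1r mulfVK //.
  by rewrite /ltv W1 -/(ltv w _ _) exprD (ltv_pmul2l hw).
rewrite -(ltv_pmul2r hw _ _ n2) mul1r mulfVK //.
by rewrite /ltv W2 -/(ltv w _ _) exprD (ltv_pmul2r hw).
Qed.

(** Two extensions of a valuation to a simple algebraic extension are conjugate.
    If every root y of the transported minimal polynomial failed, weak
    approximation would give a b in F[X] that is close to 1 at x and has positive
    value at all those y.  The polynomial of [root_transform] for b, transported to
    p2, has all its roots of positive value, hence so have its coefficients
    other than the leading one.  These values do not change when going back to
    p1, where b(x) is a root; but b(x) has value 0, a contradiction. *)
Lemma conj_extension x :
  exists y, forall Q, w (evalp p1 x Q) = w (evalp p2 y Q).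
Proof.
have [q [qm qi qx qmin]] := minpoly_exists (alg1 x).
have [r er] := closed_field_poly_normal (map_poly p2 q).
move: er; rewrite lead_coef_map (monicP qm) rmorph1 scale1r => er.
apply: contrapT => none.
have hy y : exists Q, w (evalp p1 x Q) <> w (evalp p2 y Q).
  apply: contrapT => h; apply: none; exists y => Q; apply: contrapT => h'.
  by apply: h; exists Q.
pose pp (o : option 'I_(size r)) := if o is Some _ then p2 else p1.
pose yy (o : option 'I_(size r)) := if o is Some i then r`_i else x.
have qq o : root (map_poly (pp o) q) (yy o).
  by case: o => [i|] //=; rewrite er root_prod_XsubC mem_nth.
have inv a : (forall o, evalp (pp o) (yy o) a != 0) ->
    exists b, forall o, evalp (pp o) (yy o) b * evalp (pp o) (yy o) a = 1.
  by move=> h; exact: (@evalp_inv _ _ _ None _ _ q).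
have [|b [b1 b2]] := approx_separate hw inv (i0 := None).
  move=> [i|//] _; have [Q hQ] := hy r`_i.
  exact: (separating_element qi qx (qq (Some i)) hQ).
have [X Xm hX] := root_transform b qm qi.1.
have [X1 _] := hX L p1; have [_ X2] := hX L p2.
have := X1 x qx; set c := evalp p1 x b.
have [r' er'] := closed_field_poly_normal (map_poly p2 X).
move: er'; rewrite lead_coef_map (monicP Xm) rmorph1 scale1r => er'.
have small i : (i < size r')%N -> 1 <v[w] p1 X`_i.
  move=> ir; rewrite /ltv p12 -/(ltv w _ _) -coef_map er'.
  apply: (coef_prod_XsubC_small hw) => // z zr.
  have /X2[y] : root (map_poly p2 X) z by rewrite er' root_prod_XsubC.
  rewrite er root_prod_XsubC => yr ->.
  have iy : (index y r < size r)%N by rewrite index_mem.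
  by have := b2 (Some (Ordinal iy)) isT; rewrite /= nth_index.
have sX : size X = (size r').+1.
  by rewrite -(size_map_poly p2) er' size_prod_XsubC.
have wc : w c = w 1 by exact: (wval_near1 hw).
rewrite rootE horner_coef size_map_poly sX big_ord_recr /=.
have -> : (map_poly p1 X)`_(size r') = 1.
  rewrite coef_map; move: Xm; rewrite monicE lead_coefE sX => /eqP ->.
  exact: rmorph1.
rewrite mul1r addr_eq0 => /eqP e.
have : 1 <v[w] c ^+ size r'.
  rewrite -(ltvNr hw) -e; apply: (ltv_sum hw); first exact: oner_neq0.
  move=> i _; rewrite coef_map; apply: (ltv1_mull hw); first exact: small.
  by rewrite /lev (wvalX hw _ wc) expr1n -/(lev w 1 1) levxx.
by rewrite /ltv (wvalX hw _ wc) expr1n -/(ltv w 1 1) ltvxx.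
Qed.

End ConjugateExtension.

(** * Automorphisms that preserve the valuation *)

Section SubfieldType.
Variables (L : fieldType) (A : set L).
Hypothesis hA : is_subfield A.

Definition in_subfield : {pred L} := fun x => `[< A x >].

Lemma in_subfield_divring : divring_closed in_subfield.
Proof.
have [A1 AB AV] := hA; split; first exact/asboolP.
  by move=> x y /asboolP Ax /asboolP Ay; apply/asboolP; exact: AB.
by move=> x y /asboolP Ax /asboolP Ay; apply/asboolP; exact: AV.
Qed.

HB.instance Definition _ :=
  GRing.isDivringClosed.Build L in_subfield in_subfield_divring.
Definition subfield_sort := {x : L | in_subfield x}.
HB.instance Definition _ := SubType.on subfield_sort.
HB.instance Definition _ := Choice.on subfield_sort.
HB.instance Definition _ := [SubChoice_isSubIntegralDomain of subfield_sort by <:].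
HB.instance Definition _ := [SubIntegralDomain_isSubField of subfield_sort by <:].

(** Subfields given as sets become field types with an embedding, so that what
    was shown for embeddings F -> L applies to them. *)
Lemma subfield_type : exists (F : fieldType) (j : {rmorphism F -> L}), range j = A.
Proof.
exists subfield_sort, [the {rmorphism subfield_sort -> L} of \val].
apply/seteqP; split => [_ [[x xA] _ <-]|x Ax]; first exact/asboolP.
have xA : in_subfield x by exact/asboolP.
by exists (Sub x xA).
Qed.

End SubfieldType.

Lemma exists_rmorphism (R S : nzRingType) (f : R -> S) :
  zmod_morphism f -> monoid_morphism f ->
  exists g : {rmorphism R -> S}, g =1 f.
Proof.
move=> fB fM.
pose fa := GRing.isZmodMorphism.Build R S f fB.
pose fm := GRing.isMonoidMorphism.Build R S f fM.
pose g : {rmorphism R -> S} := HB.pack f fa fm.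
by exists g.
Qed.

Lemma range_subfield (F L : fieldType) (j : {rmorphism F -> L}) :
  is_subfield (range j).
Proof.
split; first by exists 1; rewrite ?rmorph1.
  by move=> _ _ [s _ <-] [t _ <-]; exists (s - t); rewrite ?rmorphB.
by move=> _ _ [s _ <-] [t _ <-]; exists (s / t); rewrite ?fmorph_div.
Qed.

Section PartialAutomorphism.
Variables (K : fieldType) (L : closedFieldType) (iota : {rmorphism K -> L}).
Hypothesis hL : is_algebraic_closure iota.
Variables (H : orderedAbGroupType) (w : L -> option H).
Hypothesis hw : is_valuation w.

(** The graph of a valuation-preserving K-embedding of a subring of L into L.
    That such a relation is a function follows from [pi_val], and that its domain
    is a field follows from L being algebraic over K; using graphs, unions of
    chains and inverses are immediate. *)
Record partial_isometry (R : set (L * L)) : Prop := PartialIsometry {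
  pi_const : forall c, R (iota c, iota c);
  pi_sub : forall x y x' y', R (x, y) -> R (x', y') -> R (x - x', y - y');
  pi_mul : forall x y x' y', R (x, y) -> R (x', y') -> R (x * x', y * y');
  pi_val : forall x y, R (x, y) -> w x = w y }.

Definition swap_rel (R : set (L * L)) : set (L * L) := [set p | R (p.2, p.1)].

Lemma swap_isometry R : partial_isometry R -> partial_isometry (swap_rel R).
Proof.
move=> [h1 h2 h3 h4]; split; rewrite /swap_rel /=.
- exact: h1.
- by move=> x y x' y' h h'; exact: h2.
- by move=> x y x' y' h h'; exact: h3.
by move=> x y h; rewrite -(h4 _ _ h).
Qed.

Section Fixed.
Variable R : set (L * L).
Hypothesis hR : partial_isometry R.

Lemma pi_fun x y y' : R (x, y) -> R (x, y') -> y = y'.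
Proof.
move=> h h'; have := pi_val hR (pi_sub hR h h'); rewrite subrr (wval0 hw).
by move=> /esym/(val_infty hw)/eqP; rewrite subr_eq0 => /eqP.
Qed.

Lemma pi0 : R (0, 0).
Proof. by have := pi_const hR 0; rewrite rmorph0. Qed.

Lemma pi1 : R (1, 1).
Proof. by have := pi_const hR 1; rewrite rmorph1. Qed.

Lemma pi_add x y x' y' : R (x, y) -> R (x', y') -> R (x + x', y + y').
Proof.
move=> h h'; have := pi_sub hR h (pi_sub hR pi0 h').
by rewrite !sub0r !opprK.
Qed.

Lemma pi_eval x y Q : R (x, y) -> R (evalp iota x Q, evalp iota y Q).
Proof.
move=> h; elim/poly_ind: Q => [|Q c IH]; first by rewrite !rmorph0; exact: pi0.
rewrite !rmorphD !rmorphM !evalpC !evalpX.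
by apply: pi_add; [exact: pi_mul|exact: pi_const].
Qed.

(** The inverse of x is a polynomial in x over K, and the same polynomial in y
    is the inverse of y. *)
Lemma pi_inv x y : R (x, y) -> R (x^-1, y^-1).
Proof.
move=> h; have [x0|x0] := eqVneq x 0.
  have -> : y = 0 by apply: (pi_fun h); rewrite x0; exact: pi0.
  by rewrite x0 invr0; exact: pi0.
have y0 : y != 0 by rewrite -(wval_eq0 hw (pi_val hR h)).
have [q [_ qi qx _]] := minpoly_exists (hL x).
have qy : root (map_poly iota q) y.
  have := pi_eval q h; rewrite evalp_root (eqP qx : evalp iota x q = 0) => h'.
  by apply/eqP; apply: (pi_fun h'); exact: pi0.
pose yy (b : bool) := if b then x else y.
have [//||Q hQ] := @evalp_inv K L bool true (fun=> iota) yy q 'X qi.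
- by case.
- by rewrite evalpX.
have /(_ Q) := pi_eval _ h.
have -> : evalp iota x Q = x^-1.
  by apply: (mulIf x0); have := hQ true; rewrite evalpX mulVf.
have -> // : evalp iota y Q = y^-1.
by apply: (mulIf y0); have := hQ false; rewrite evalpX mulVf.
Qed.

Definition pi_dom : set L := [set x | exists y, R (x, y)].

Lemma pi_dom_subfield : is_subfield pi_dom.
Proof.
split; first by exists 1; exact: pi1.
  by move=> x x' [y h] [y' h']; exists (y - y'); exact: pi_sub.
move=> x x' [y h] [y' h']; exists (y / y'); apply: (pi_mul hR h).
exact: pi_inv.
Qed.

Lemma alg_lift (F : fieldType) (j : {rmorphism F -> L}) :
  (forall c, range j (iota c)) -> forall x, algebraicOver j x.
Proof.
move=> hj x; have [P P0 Px] := hL x.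
have [P' eP] : exists P', map_poly j P' = map_poly iota P.
  by apply: poly_over_range => i; rewrite coef_map; exact: hj.
exists P'; last by rewrite eP.
by rewrite -(map_poly_eq0 j) eP map_poly_eq0.
Qed.


(** [conj_extension], applied to the two projections of R to L, seen as embeddings of the
    domain of R. *)
Lemma pi_adjoin x :
  exists R', [/\ partial_isometry R', R `<=` R' & exists y, R' (x, y)].
Proof.
have [F [j1 rj1]] := subfield_type pi_dom_subfield.
have dom t : exists y, R (j1 t, y).
  by have : pi_dom (j1 t) by rewrite -rj1; exists t.
pose f t := xget 0 [set y | R (j1 t, y)].
have fP t : R (j1 t, f t).
  by rewrite /f; case: xgetP => [y -> //|]; have [y h] := dom t; move=> /(_ y).
have [j2 ej2] : exists g : {rmorphism F -> L}, g =1 f.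
  apply: exists_rmorphism.
    move=> s t; apply: (pi_fun (fP _)); rewrite rmorphB.
    exact: pi_sub.
  split; first by apply: (pi_fun (fP _)); rewrite rmorph1; exact: pi1.
  by move=> s t; apply: (pi_fun (fP _)); rewrite rmorphM; exact: pi_mul.
have j12 t : R (j1 t, j2 t) by rewrite ej2.
have alg1 : forall x, algebraicOver j1 x.
  by apply: alg_lift => c; rewrite rj1; exists (iota c); exact: pi_const.
have alg2 : forall x, algebraicOver j2 x.
  apply: alg_lift => c.
  have [t _ et] : range j1 (iota c) by rewrite rj1; exists (iota c); exact: pi_const.
  exists t => //; apply: (pi_fun (j12 t)); rewrite et; exact: pi_const.
have [y hy] := conj_extension hw (fun t => pi_val hR (j12 t)) alg1 alg2 x.
exists (range (fun Q => (evalp j1 x Q, evalp j2 y Q))); split.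
- split.
  + move=> c.
    have [t _ et] : range j1 (iota c) by rewrite rj1; exists (iota c); exact: pi_const.
    exists t%:P => //; rewrite !evalpC et; congr pair.
    by apply/esym/(pi_fun (pi_const hR c)); rewrite -{1}et.
  + move=> x1 y1 x2 y2 [Q1 _ [<- <-]] [Q2 _ [<- <-]]; exists (Q1 - Q2) => //.
    by rewrite !rmorphB.
  + move=> x1 y1 x2 y2 [Q1 _ [<- <-]] [Q2 _ [<- <-]]; exists (Q1 * Q2) => //.
    by rewrite !rmorphM.
  by move=> x1 y1 [Q _ [<- <-]]; exact: hy.
- move=> [x1 y1] h.
  have [t _ et] : range j1 x1 by rewrite rj1; exists y1.
  exists t%:P => //; rewrite !evalpC et; congr pair.
  by apply/esym/(pi_fun h); rewrite -et.
by exists y, 'X; rewrite ?evalpX.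
Qed.

End Fixed.

(** Zorn's lemma; the empty relation is admitted as well, since the union of the
    empty chain has to be covered. *)
Lemma pi_maximal R0 : partial_isometry R0 ->
  exists R, [/\ partial_isometry R, R0 `<=` R & forall R', partial_isometry R' ->
    R `<=` R' -> R' `<=` R].
Proof.
move=> hR0.
pose P := [set R | R = set0 \/ (partial_isometry R /\ R0 `<=` R)].
have [|R [PR Rmax]] := @Zorn_bigcup _ P.
  move=> C CP Ctot; have [none|] := pselect (forall X, C X -> X = set0).
    by left; apply/seteqP; split => // p [X CX]; rewrite (none _ CX).
  move=> /existsNP[X /not_implyP[CX X0]]; right.
  have good Y : C Y -> Y = set0 \/ partial_isometry Y.
    by move=> /CP[]; [left|case; right].
  have [//|[hX R0X]] := CP _ CX.
  have two p p' : (\bigcup_(Y in C) Y) p -> (\bigcup_(Y in C) Y) p' ->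
      exists Y, [/\ C Y, Y p, Y p' & partial_isometry Y].
    move=> [Y CY Yp] [Z CZ Zp].
    have [hY|hZ] := Ctot _ _ CY CZ.
      exists Z; split => //; first exact: hY.
      by case: (good _ CZ) => // Z0; rewrite Z0 in Zp.
    exists Y; split => //; first exact: hZ.
    by case: (good _ CY) => // Y0; rewrite Y0 in Yp.
  split; last by move=> p /R0X Xp; exists X.
  split.
  - by move=> c; exists X => //; exact: pi_const.
  - move=> x y x' y' h h'; have [Y [CY Y1 Y2 hY]] := two _ _ h h'.
    by exists Y => //; exact: pi_sub.
  - move=> x y x' y' h h'; have [Y [CY Y1 Y2 hY]] := two _ _ h h'.
    by exists Y => //; exact: pi_mul.
  by move=> x y h; have [Y [CY Y1 _ hY]] := two _ _ h h; exact: (pi_val hY Y1).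
have R00 : R0 (iota 0, iota 0) by exact: pi_const.
have {PR} [hR R0R] : partial_isometry R /\ R0 `<=` R.
  case: PR => // R_0; exfalso; apply: (Rmax R0); last by right; split.
  rewrite R_0; split; first exact: sub0set.
  by move=> /(_ _ R00).
exists R; split => // R' hR' RR'; apply: contrapT => nR'R.
apply: (Rmax R'); first by split.
by right; split => //; exact: subset_trans RR'.
Qed.

(** A maximal isometry is everywhere defined by [pi_adjoin], and it is onto by the
    same lemma for the inverse relation. *)
Lemma pi_total R0 : partial_isometry R0 ->
  exists R, [/\ partial_isometry R, R0 `<=` R, forall x, exists y, R (x, y)
    & forall y, exists x, R (x, y)].
Proof.
move=> /pi_maximal[R [hR R0R Rmax]]; exists R; split => //.
  move=> x; have [R' [hR' RR' [y h]]] := pi_adjoin hR x.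
  by exists y; exact: Rmax hR' RR' _ h.
move=> y; have [R' [hR' RR' [x h]]] := pi_adjoin (swap_isometry hR) y.
exists x; have := Rmax _ (swap_isometry hR'); apply => //.
by move=> -[a b] hab; apply: RR'.
Qed.

(** The only use of the assumption that a is fixed by the decomposition group. *)
Lemma conjugate_isometry_eq a a' :
  henselization iota w a ->
  (forall Q, w (evalp iota a Q) = w (evalp iota a' Q)) -> a' = a.
Proof.
move=> [_ afix] haa'.
pose R0 := range (fun Q => (evalp iota a Q, evalp iota a' Q)).
have hR0 : partial_isometry R0.
  split.
  - by move=> c; exists c%:P; rewrite ?evalpC.
  - move=> x y x' y' [Q _ [<- <-]] [Q' _ [<- <-]]; exists (Q - Q') => //.
    by rewrite !rmorphB.
  - move=> x y x' y' [Q _ [<- <-]] [Q' _ [<- <-]]; exists (Q * Q') => //.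
    by rewrite !rmorphM.
  by move=> x y [Q _ [<- <-]]; exact: haa'.
have [R [hR R0R tot sur]] := pi_total hR0.
pose s (x : L) : L := xget 0 [set y | R (x, y)].
have sP x : R (x, s x).
  by rewrite /s; case: xgetP => [y -> //|]; have [y h] := tot x; move=> /(_ y).
have sE x y : R (x, y) -> s x = y by apply: pi_fun.
have sc c : s (iota c) = iota c by apply: sE; exact: (pi_const hR).
have ea : s a = a'.
  by apply/sE/R0R; exists 'X => //; congr pair; exact: evalpX.
have sroot p x : root (map_poly iota p) x = root (map_poly iota p) (s x).
  by rewrite !evalp_root (wval_eq0 hw (pi_val hR (pi_eval hR p (sP x)))).
have ssep x : sep_closure iota (s x) <-> sep_closure iota x.
  by split=> -[p [h1 h2 h3 h4]]; exists p; split => //;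
    [rewrite sroot|rewrite -sroot].
rewrite -ea; apply: afix; split; last by move=> x _; rewrite -(pi_val hR (sP x)).
split.
- split.
  + by move=> x /ssep.
  + move=> x y _ _ e; have := sP x; rewrite e => h.
    by apply: (pi_fun (swap_isometry hR) (x := s y)) => //; exact: sP.
  + move=> y sy; have [x xy] := sur y; exists x; last exact: sE.
    by apply/ssep; rewrite (sE _ _ xy).
- by move=> x y _ _; apply: sE; exact: (pi_add hR (sP x) (sP y)).
- by move=> x y _ _; apply: sE; exact: (pi_mul hR (sP x) (sP y)).
by move=> _ [c _ <-].
Qed.

End PartialAutomorphism.

(** * Polynomials whose roots are all near to an element of the henselization *)

(** With R the remainder of Q g' modulo g, Lagrange interpolation at the roots of g
    gives R as the sum of the Q(y) g / (X - y), whose coefficient in degree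
    deg g - 1 is the sum of the Q(y). *)
Lemma trace_in_base (K L : fieldType) (p : {rmorphism K -> L}) (g Q : {poly K})
    (rs : seq L) : map_poly p g = \prod_(y <- rs) ('X - y%:P) -> uniq rs ->
  range p (\sum_(y <- rs) evalp p y Q).
Proof.
move=> eg urs; pose P y := \prod_(u <- rem y rs) ('X - u%:P).
have gP y : y \in rs -> map_poly p g = ('X - y%:P) * P y.
  by move=> yr; rewrite eg (big_rem y yr).
have g0 : g != 0.
  by rewrite -(map_poly_eq0 p) eg monic_neq0 // monic_prod_XsubC.
have sg : size g = (size rs).+1 by rewrite -(size_map_poly p) eg size_prod_XsubC.
have sP y : y \in rs -> size (P y) = size rs.
  move=> yr; rewrite size_prod_XsubC size_rem //.
  by move: yr; case: (rs).
pose R := (Q * g^`()) %% g.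
pose S := \sum_(y <- rs) evalp p y Q *: P y.
have RS : map_poly p R = S.
  apply/eqP; rewrite -subr_eq0; apply/eqP.
  apply: (@roots_geq_poly_eq0 _ _ rs) => //; last first.
    rewrite (leq_trans (size_polyD _ _)) // geq_max size_polyN size_map_poly.
    rewrite -ltnS -sg ltn_modp g0 /= /S big_seq.
    apply: (big_ind (fun q : {poly L} => (size q <= size rs)%N)).
    - by rewrite size_poly0.
    - move=> u v su sv; rewrite (leq_trans (size_polyD _ _)) //.
      by rewrite geq_max su sv.
    by move=> y yr; rewrite (leq_trans (size_scale_leq _ _)) // sP.
  apply/allP => z zr; rewrite rootE hornerD hornerN subr_eq0; apply/eqP.
  have gz : root (map_poly p g) z by rewrite eg root_prod_XsubC.
  have -> : (map_poly p R).[z] = evalp p z Q * (P z).[z].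
    have := congr1 (evalp p z) (divp_eq (Q * g^`()) g).
    rewrite -/R rmorphD !rmorphM (eqP gz : evalp p z g = 0) mulr0 add0r.
    rewrite (evalpE _ _ R) => <-; congr (_ * _).
    rewrite evalpE -deriv_map (gP z zr) derivM derivXsubC mul1r hornerD hornerM.
    by rewrite hornerXsubC subrr mul0r addr0.
  rewrite horner_sum (big_rem z zr) /= hornerZ big1_seq ?addr0 // => y /andP[_ yr].
  rewrite hornerZ (rootP _) ?mulr0 // root_prod_XsubC.
  move: yr; rewrite !mem_rem_uniq // !inE => /andP[yz yr].
  by rewrite eq_sym yz.
exists R`_(size rs).-1 => //.
rewrite -coef_map RS coef_sum big_seq [RHS]big_seq; apply: eq_bigr => y yr.
rewrite coefZ -[(size rs).-1](congr1 predn (sP y yr)) -lead_coefE.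
by rewrite (monicP (monic_prod_XsubC _ _ _)) mulr1.
Qed.

Section Core.
Variables (K : fieldType) (L : closedFieldType) (iota : {rmorphism K -> L}).
Hypothesis hL : is_algebraic_closure iota.
Variables (H : orderedAbGroupType) (w : L -> option H).
Hypothesis hw : is_valuation w.

Lemma wval_prod (s : seq L) (f g : L -> L) :
  {in s, forall z, w (f z) = w (g z)} ->
  w (\prod_(z <- s) f z) = w (\prod_(z <- s) g z).
Proof.
elim: s => [|z s IH] h; rewrite ?big_nil // !big_cons; apply: (wvalM hw).
  by apply: h; rewrite mem_head.
by apply: IH => u us; apply: h; rewrite inE us orbT.
Qed.

Lemma lev_prod (s : seq L) (f g : L -> L) :
  {in s, forall z, f z <=v[w] g z} ->
  \prod_(z <- s) f z <=v[w] \prod_(z <- s) g z.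
Proof.
elim: s => [|z s IH] h; rewrite ?big_nil ?levxx // !big_cons; apply: (lev_mul hw).
  by apply: h; rewrite mem_head.
by apply: IH => u us; apply: h; rewrite inE us orbT.
Qed.

(** If y is farther from a than all the z, then the product of the y - z has the value of
    (y - a)^n.  The ratio rho of the two products is thus a product of
    the (z - a) / (y - a), all of positive value, among them (z0 - a) / (y - a). *)
Lemma far_ratio (a y : L) (zs : seq L) (z0 : L) : z0 \in zs -> z0 - a != 0 ->
  {in zs, forall z, y - a <v[w] z - a} ->
  let d := y - a in
  exists2 rho, w (\prod_(z <- zs) (a - z)) = w (rho * \prod_(z <- zs) (y - z))
   & 1 <v[w] rho /\ z0 - a <=v[w] rho * d.
Proof.
move=> z0s z0a h d.
have d0 : d != 0 := ltv_neq0 hw (h _ z0s).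
pose e := \prod_(z <- zs) (z - a).
pose D := \prod_(z <- zs) d.
have D0 : D != 0 by rewrite prodf_seq_neq0; apply/allP => z _; exact/implyP.
exists (e / D).
  have -> : w (\prod_(z <- zs) (a - z)) = w e.
    by apply: wval_prod => z _; rewrite -(wvalN hw) opprB.
  rewrite -[in LHS](mulfVK D0 e); apply: (wvalM hw) => //.
  apply: wval_prod => z zs'; have -> : y - z = d - (z - a).
    by rewrite /d opprB addrA subrK.
  by apply/esym/(wvalBl hw); exact: h.
have le : z0 - a <=v[w] e / D * d.
  rewrite -(lev_pmul2r hw _ _ D0) mulrAC mulfVK //.
  
  rewrite /D /e !(big_rem z0 z0s) /= -[X in _ <=v[_] X]mulrA (lev_pmul2l hw) //.
  rewrite [d * _]mulrC (lev_pmul2r hw) //; apply: lev_prod => z zs'.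
  by apply/ltvW/h; exact: mem_rem zs'.
split=> //; rewrite -(ltv_pmul2r hw _ _ d0) mul1r.
exact: ltv_le_trans (h _ z0s) le.
Qed.

(** See the explanation at the beginning: b and c' are the two factors of the
    weight C. *)
Lemma not_all_roots_near a f : henselization iota w a ->
  f \is monic -> (1 < size f)%N ->
  (forall z, root (map_poly iota f) z -> forall c, a - iota c <v[w] z - a) ->
  False.
Proof.
move=> ha fm f1 near.
have [zs ezs] := closed_field_poly_normal (map_poly iota f).
move: ezs; rewrite lead_coef_map (monicP fm) rmorph1 scale1r => ezs.
have zsE z : (z \in zs) = root (map_poly iota f) z by rewrite ezs root_prod_XsubC.
have [z0 z0s] : exists z0, z0 \in zs.
  have : size zs != 0%N.
    by apply: contraTneq f1 => e; rewrite -(size_map_poly iota) ezs size_prod_XsubC e.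
  by case: (zs) => // z s _; exists z; rewrite mem_head.
have nearz z : z \in zs -> forall c, a - iota c <v[w] z - a.
  by rewrite zsE; exact: near.
have anK c : a - iota c != 0 := ltv_neq0 hw (nearz z0 z0s c).
have [[g [gm gi ga gs]] _] := ha.
have [rs ers] := closed_field_poly_normal (map_poly iota g).
move: ers; rewrite lead_coef_map (monicP gm) rmorph1 scale1r => ers.
have rsE y : (y \in rs) = root (map_poly iota g) y by rewrite ers root_prod_XsubC.
have urs : uniq rs.
  by rewrite -separable_prod_XsubC -ers separable_map.
have ar : a \in rs by rewrite rsE.
have ia : (index a rs < size rs)%N by rewrite index_mem.
pose i0 := Ordinal ia; have ri0 : rs`_i0 = a by rewrite nth_index.
have rsi (i : 'I_(size rs)) : root (map_poly iota g) rs`_i by rewrite -rsE mem_nth.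
pose ev (i : 'I_(size rs)) := evalp iota rs`_i.
have inv u : (forall i, ev i u != 0) -> exists v, forall i, ev i v * ev i u = 1.
  by move=> h; exact: (@evalp_inv _ _ _ i0 (fun=> iota) (fun i => rs`_i) g u gi rsi (h i0)).
have ne_a (i : 'I_(size rs)) : i != i0 -> rs`_i != a.
  by apply: contra => /eqP h; rewrite -val_eqE /= -h index_uniq.
have [|b [b0 b1]] := approx_separate hw inv (i0 := i0).
  move=> i ii0; have [Q hQ] : exists Q, w (evalp iota a Q) <> w (evalp iota rs`_i Q).
    apply: contrapT => none; have /eqP := ne_a i ii0; apply.
    apply: (conjugate_isometry_eq hL hw ha) => Q; apply: contrapT => h.
    by apply: none; exists Q.
  have [u [u1 u2]] := separating_element hw (fun=> erefl) hL hL gi ga (rsi i) hQ.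
  by exists u; rewrite /ev ri0.
have [c' c'P] : exists c', [/\ 1 <v[w] ev i0 c' - 1, forall i, 1 <=v[w] ev i c'
    & forall i, i != i0 -> forall c, a - iota c <v[w] ev i c' * (rs`_i - a)].
  have [e0|e0] := eqVneq (evalp iota a f) 0.
    (* If f(a) = 0, then all the conjugates of a are roots of f, hence near to a
       themselves, and no improvement of b is called for. *)
    have gf : g %| f.
      apply/negPn; rewrite -irreducible_poly_coprime //; apply/negP => cop.
      move: cop; rewrite -(coprimep_map iota) => /coprimep_root /(_ ga).
      by rewrite -evalpE e0 eqxx.
    exists 1; split=> [|i|i _ c]; rewrite rmorph1.
    - by rewrite subrr (ltv0E hw) oner_neq0.
    - exact: levxx.
    by rewrite mul1r; apply: near; rewrite evalp_root (evalp_dvd gf (rsi i)).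
  have [m [r [m0 r0 er]]] := wval_torsion hw (hL _) e0.
  (* The factor 1 - b gives t a positive value at a and is harmless at the other
     conjugates. *)
  pose t := f ^+ m * (r^-1)%:P * (1 - b).
  have [c' hc'] := approx_one hw inv t.
  have nr : iota r != 0 by rewrite fmorph_eq0.
  exists c'; split=> [|i|i ii0 c].
  - have [_ + _] := hc' i0; apply.
    rewrite /ev ri0 !rmorphM rmorphXn evalpC rmorphB rmorph1 fmorphV.
    apply: (ltv1_mulr hw); last by rewrite (ltv_distrC hw) -ri0.
    rewrite -(lev_pmul2r hw _ _ nr) mul1r mulfVK //.
    by rewrite /lev er -/(lev w _ _) levxx.
  - by have [] := hc' i.
  have [c'1 _ c't] := hc' i.
  have [nr_i|] := pselect (forall c, a - iota c <v[w] rs`_i - a).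
    apply: (ltv_le_trans (nr_i c)).
    by rewrite -[X in X <=v[_] _]mul1r; apply: (lev_mul2r hw).
  (* This conjugate is farther from a than some element of K, hence farther than
     every root of f. *)
  move=> /existsNP[c0 /negP]; rewrite -levNgt => far.
  have far' : {in zs, forall z, rs`_i - a <v[w] z - a}.
    by move=> z zz; apply: lev_lt_trans far (nearz _ zz _).
  have z0a : z0 - a != 0.
    by rewrite subr_eq0; apply: contraNneq e0 => <-; rewrite -evalp_root -zsE.
  have [rho erho [rho1 le]] := far_ratio z0s z0a far'.
  have prodE x : evalp iota x f = \prod_(z <- zs) (x - z).
    by rewrite evalpE ezs horner_prod; apply: eq_bigr => z _; rewrite hornerXsubC.
  rewrite -!prodE in erho.
  have rho0 : rho != 0 by apply: contraTneq e0 => r00; rewrite (wval_eq0 hw erho) r00 mul0r eqxx.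
  have rm0 : rho ^+ m != 0 by rewrite expf_neq0.
  have tE : w (ev i t * rho ^+ m) = w 1.
    rewrite /t !rmorphM rmorphXn evalpC rmorphB rmorph1 fmorphV.
    have wb : w (1 - ev i b) = w 1 by apply: (wvalBl hw); exact: b1.
    rewrite -mulrA [_ * rho ^+ m]mulrC mulrA -[RHS](congr1 w (mulr1 1)); apply: (wvalM hw) => //.
    rewrite mulrAC -[RHS](congr1 w (mulfV nr)); apply: (wvalM hw) => //.
    rewrite -er mulrC -exprMn; exact/esym/(wvalX hw).
  have rhom : rho <=v[w] rho ^+ m.
    case: (m) m0 => // k _; rewrite exprSr -[X in X <=v[_] _]mul1r.
    by apply: (lev_mul2r hw); rewrite -(expr1n _ k); apply/(lev_X hw)/ltvW.
  have t1 : ev i t <v[w] 1.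
    rewrite -(ltv_pmul2r hw _ _ rm0) mul1r /ltv tE -/(ltv w _ _).
    exact: ltv_le_trans rho1 rhom.
  have c'rho : rho ^+ m <=v[w] ev i c'.
    have t0 : ev i t != 0 by exact: (ltv_neq0 hw t1).
    rewrite -(lev_pmul2r hw _ _ t0) mulrC /lev tE -/(lev w _ _); exact: c't.
  apply: ltv_le_trans (nearz _ z0s c) (lev_trans le _).
  apply: (lev_mul2r hw); exact: lev_trans rhom c'rho.
case: c'P => c'0 c'1 c'2.
pose C := b * c'.
have C0 : 1 <v[w] ev i0 C - 1.
  rewrite rmorphM.
  have -> : ev i0 b * ev i0 c' - 1 = (ev i0 b - 1) * ev i0 c' + (ev i0 c' - 1).
    by rewrite mulrBl mul1r addrA subrK.
  by apply: (ltv_add hw) => //; exact: (ltv1_mull hw).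
have sumE Q : \sum_(y <- rs) evalp iota y Q = \sum_i ev i Q.
  by rewrite (big_nth 0) big_mkord.
have [k1 _ ek1] := trace_in_base C ers urs.
have [k2 _ ek2] := trace_in_base (C * 'X) ers urs.
rewrite sumE in ek1; rewrite sumE in ek2.
have wk1 : w (iota k1) = w 1.
  apply: (wval_near1 hw); rewrite ek1 (bigD1 i0) // addrAC; apply: (ltv_add hw) => //.
  apply: (ltv_sum hw) => [|i /andP[_ ii0]]; first exact: oner_neq0.
  by rewrite rmorphM; apply: (ltv1_mull hw) => //; exact: b1.
have k10 : iota k1 != 0 by rewrite (wval_eq0 hw wk1) oner_neq0.
pose t := a - iota (k2 / k1).
(* iota k1 has value 0, so the comparison below is impossible. *)
have : t <v[w] t * iota k1.
  have -> : t * iota k1 = \sum_i ev i C * (a - rs`_i).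
    rewrite /t mulrBl fmorph_div mulfVK // ek1 ek2 mulr_sumr -sumrB.
    by apply: eq_bigr => i _; rewrite [ev i (C * _)]rmorphM [ev i 'X]evalpX mulrBr [a * _]mulrC.
  apply: (ltv_sum hw) => [|i _]; first exact: anK.
  have [->|ii0] := eqVneq i i0; first by rewrite ri0 subrr mulr0 (ltv0E hw) anK.
  apply: (ltv_le_trans (c'2 i ii0 (k2 / k1))).
  rewrite rmorphM -mulrA -(levNr hw) -!mulrN opprB -[X in X <=v[_] _]mul1r.
  by apply: (lev_mul2r hw); apply/ltvW/b1.
by rewrite mulrC /ltv (wval_mul1l hw _ wk1) -/(ltv w t t) ltvxx.
Qed.

End Core.

(** * The separable closure is a field *)

Section SeparableClosure.
Variables (K L : fieldType) (iota : {rmorphism K -> L}).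

Lemma simple_extension (F : fieldType) (p : {rmorphism F -> L}) x :
  algebraicOver p x ->
  exists (E : fieldExtType F) (j : {rmorphism E -> L}),
    (forall c, j c%:A = p c) /\ exists x', j x' = x.
Proof.
move=> /minpoly_exists[q [_ qi qx _]].
exists (SubFieldExtType qx qi), [the {rmorphism _ -> L} of @subfx_inj F L p x q].
split=> [c|]; first exact: (subfx_inj_base qx (irredp_neq0 qi)).
by exists (subfx_root p x q); exact: (subfx_inj_root qx (irredp_neq0 qi)).
Qed.

(** A finite extension of K that contains copies of x and y; in it the theory of
    separable elements of finite extensions is available. *)
Lemma double_extension x y : algebraicOver iota x -> algebraicOver iota y ->
  exists (E : fieldExtType K) (j : {rmorphism E -> L}),
    [/\ forall c, j c%:A = iota c, exists x', j x' = x & exists y', j y' = y].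
Proof.
move=> /simple_extension[E1 [j1 [j1c [x' ex]]]] [q q0 qy].
have /simple_extension[E2 [j2 [j2c [y' ey]]]] : algebraicOver j1 y.
  exists (map_poly (in_alg E1) q); first by rewrite map_poly_eq0.
  by rewrite -map_poly_comp (eq_map_poly (g := iota)).
exists (baseFieldType E2), j2; split.
- by move=> c; rewrite baseField_scaleE -j1c -j2c.
- by exists (x'%:A); rewrite j2c.
by exists y'.
Qed.

Lemma sep_closureP x : sep_closure iota x <->
  exists2 p : {poly K}, separable_poly p & root (map_poly iota p) x.
Proof.
split=> [[p [_ _ px ps]]|[p ps px]]; first by exists p.
have p0 := separable_poly_neq0 ps.
have [q [qm qi qx qmin]] := minpoly_exists (ex_intro2 _ _ p p0 px).
exists q; split => //; apply: dvdp_separable ps.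
exact/qmin/eqP.
Qed.

Lemma sep_closure_alg x : sep_closure iota x -> algebraicOver iota x.
Proof. by move=> /sep_closureP[p ps px]; exists p => //; exact: separable_poly_neq0. Qed.

Lemma separable_elementE (E : fieldExtType K) (j : {rmorphism E -> L}) u :
  (forall c, j c%:A = iota c) ->
  separable_element 1 u <-> sep_closure iota (j u).
Proof.
move=> jc; have jp p : map_poly j (map_poly (in_alg E) p) = map_poly iota p.
  by rewrite -map_poly_comp; apply: eq_map_poly => c; exact: jc.
rewrite sep_closureP; split.
  move=> /separable_elementP[f [/polyOver1P[p ->] pu ps]]; exists p.
    by rewrite separable_map in ps.
  by rewrite -jp fmorph_root.
move=> [p ps pu]; apply/separable_elementP; exists (map_poly (in_alg E) p).
split; last by rewrite separable_map.
  by apply/polyOver1P; exists p.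
by rewrite -jp fmorph_root in pu.
Qed.

(** The primitive element theorem puts x and y into a simple extension with a
    separable generator, all of whose elements are separable. *)
Lemma sep_closure_subfield : is_subfield (sep_closure iota).
Proof.
suff h x y : sep_closure iota x -> sep_closure iota y ->
    sep_closure iota (x - y) /\ sep_closure iota (x / y).
  split; last 2 first.
  - by move=> x y sx sy; have [] := h x y sx sy.
  - by move=> x y sx sy; have [] := h x y sx sy.
  apply/sep_closureP; exists ('X - 1%:P); first by rewrite unlock derivXsubC coprimep1.
  by rewrite rmorphB /= map_polyX map_polyC /= rmorph1 root_XsubC.
move=> sx sy.
have [E [j [jc [x' ex] [y' ey]]]] :=
  double_extension (sep_closure_alg sx) (sep_closure_alg sy).
move: sx sy; rewrite -ex -ey -fmorph_div -rmorphB -!(separable_elementE _ jc).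
move=> sx sy.
have /(separable_elementS (subv_adjoin _ y')) sx' := sx.
have [z defz] := Primitive_Element_Theorem x' sy.
have sz : separable_element 1 z.
  apply: adjoin_separable sy (adjoin_separable sx' _).
  by rewrite defz base_separable ?memv_adjoin.
have hx : x' \in <<1; z>>%VS by rewrite -defz memv_adjoin.
have hy : y' \in <<1; z>>%VS by rewrite -defz subvP_adjoin ?memv_adjoin.
by split; apply: (adjoin_separableP sz); rewrite ?rpredB ?rpred_div.
Qed.

Lemma sep_exponent x : algebraicOver iota x ->
  exists2 n, [pchar L].-nat n & sep_closure iota (x ^+ n).
Proof.
move=> /simple_extension[E [j [jc [x' ex]]]].
have [n /andP[pn sn]] := separable_exponent_pchar 1 x'.
exists n; first by rewrite (eq_pnat _ (fmorph_pchar j)).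
by rewrite -ex -rmorphXn; apply/(separable_elementE _ jc).
Qed.

End SeparableClosure.

(** * Degrees and bases *)

Section Degrees.
Variables (L : fieldType).

Lemma subfieldM (A : set L) x y : is_subfield A -> A x -> A y -> A (x * y).
Proof.
move=> [A1 _ AV] Ax Ay; rewrite -[y]invrK; apply: (AV) => //.
by rewrite -div1r; exact: AV.
Qed.

Lemma subfield0 (A : set L) : is_subfield A -> A 0.
Proof. by move=> [A1 AB _]; rewrite -(subrr 1); exact: AB. Qed.

Lemma subfieldN (A : set L) x : is_subfield A -> A x -> A (- x).
Proof. by move=> hA Ax; rewrite -sub0r; have [_ AB _] := hA; apply: AB => //; exact: subfield0. Qed.

Lemma subfieldX (A : set L) x n : is_subfield A -> A x -> A (x ^+ n).
Proof.
move=> hA Ax; elim: n => [|n IH]; first by rewrite expr0; case: hA.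
by rewrite exprS; exact: subfieldM.
Qed.

Lemma evalp_adjoin (F : fieldType) (p : {rmorphism F -> L}) z Q :
  adjoin (range p) z (evalp p z Q).
Proof.
move=> A [hA GA].
have Az : A z by apply: GA; right.
have Ap c : A (p c) by apply: GA; left; exists c.
have [_ AB _] := hA.
elim/poly_ind: Q => [|Q c IH]; first by rewrite rmorph0; exact: (subfield0 hA).
rewrite rmorphD rmorphM evalpC evalpX -[p c]opprK.
exact: (AB _ _ (subfieldM hA IH Az) (subfieldN hA (Ap c))).
Qed.

Variables (F : fieldType) (p : {rmorphism F -> L}) (z : L) (q : {poly F}).
Hypotheses (qi : irreducible_poly q) (qz : root (map_poly p q) z).
Hypothesis qmin : forall Q, evalp p z Q = 0 -> q %| Q.

Lemma adjoin_evalp : adjoin (range p) z = range (evalp p z).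
Proof.
apply/seteqP; split.
  apply: smallest_sub; last first.
    move=> _ [[c _ <-]|->]; first by exists c%:P => //; exact: evalpC.
    by exists 'X => //; exact: evalpX.
  split; first by exists 1 => //; exact: rmorph1.
    by move=> _ _ [P _ <-] [Q _ <-]; exists (P - Q) => //; exact: rmorphB.
  move=> _ _ [P _ <-] [Q _ <-].
  have [->|Q0] := eqVneq (evalp p z Q) 0.
    by exists 0 => //; rewrite rmorph0 invr0 mulr0.
  have [Q' hQ'] := @evalp_inv _ _ unit tt (fun=> p) (fun=> z) q Q qi (fun=> qz) Q0.
  exists (P * Q') => //; rewrite rmorphM; congr (_ * _).
  by apply: (mulIf Q0); rewrite mulVf // (hQ' tt).
move=> _ [Q _ <-]; exact: evalp_adjoin.
Qed.

Lemma degree_adjoin : has_degree (adjoin (range p) z) (range p) (size q).-1.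
Proof.
have q0 := irredp_neq0 qi; have sq : (0 < size q)%N by rewrite size_poly_gt0.
have polyE (d : 'I_(size q).-1 -> F) :
    exists2 Q : {poly F}, (size Q < size q)%N & evalp p z Q = \sum_i p (d i) * z ^+ i /\
      forall i : 'I_(size q).-1, Q`_i = d i.
  pose d' i := if insub i is Some i' then d i' else 0.
  have d'E i : d' (val i) = d i by rewrite /d' valK.
  exists (\poly_(i < (size q).-1) d' i).
    by rewrite (leq_ltn_trans (size_poly _ _)) // prednK.
  split=> [|i]; last by rewrite coef_poly ltn_ord d'E.
  rewrite poly_def rmorph_sum; apply: eq_bigr => i _.
  by rewrite -mul_polyC rmorphM rmorphXn evalpC evalpX d'E.
exists (fun i => z ^+ i); split.
- by move=> i; rewrite adjoin_evalp; exists 'X^i => //; rewrite rmorphXn evalpX.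
- move=> c hc sum0.
  have /choice[d hd] : forall i, exists t, p t = c i.
    by move=> i; have [t _ e] := hc i; exists t.
  have [Q sQ [eQ Qi]] := polyE d.
  have /qmin qQ : evalp p z Q = 0.
    by rewrite eQ -[RHS]sum0; apply: eq_bigr => i _; rewrite hd.
  move=> i; rewrite -hd -Qi; suff -> : Q = 0 by rewrite coef0 rmorph0.
  by apply/eqP/negPn/negP => /dvdp_leq /(_ qQ); rewrite leqNgt sQ.
rewrite adjoin_evalp => _ [Q _ <-].
pose r : {poly F} := (Q %% q)%R.
exists (fun i => p r`_i); split=> [i|]; first by exists r`_i.
rewrite [in LHS](divp_eq Q q) rmorphD rmorphM (eqP qz : evalp p z q = 0) mulr0 add0r.
have s : (size r <= (size q).-1)%N by rewrite -ltnS prednK // ltn_modp.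
rewrite evalpE (horner_coef_wide _ (n := (size q).-1)) ?size_map_poly //.
by apply: eq_bigr => i _; rewrite coef_map.
Qed.

End Degrees.

Section ExtractBasis.
Variables (L : fieldType) (F : set L).
Hypothesis hF : is_subfield F.

(** Linear independence is tested on one family at a time, so a relation with
    coefficients in ds is handled by expressing ds through independent members. *)
Lemma extract_basis (ds : seq L) : exists es : seq L,
  [/\ {subset es <= ds}, lin_indep F (fun i : 'I_(size es) => es`_i) &
    forall d, d \in ds -> exists c : 'I_(size es) -> L,
      (forall i, F (c i)) /\ d = \sum_i c i * es`_i].
Proof.
have F0 := subfield0 hF; have [F1 _ FV] := hF.
elim: ds => [|d ds [es [sub ind span]]].
  by exists [::]; split => // c _ _ [].
have [[c0 hc0]|nspan] := pselect (exists c : 'I_(size es) -> L,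
      (forall i, F (c i)) /\ d = \sum_i c i * es`_i).
  exists es; split => // [x /sub xs|x]; first by rewrite inE xs orbT.
  by rewrite inE => /orP[/eqP->|/span//]; exists c0.
exists (d :: es); split.
- by move=> x; rewrite !inE => /orP[->//|/sub->]; rewrite orbT.
- move=> c hc; rewrite big_ord_recl /= => e.
  have c00 : c ord0 = 0.
    apply/eqP/negPn/negP => c0; apply: nspan.
    exists (fun i => - (c (lift ord0 i) / c ord0)); split.
      by move=> i; apply: (subfieldN hF); exact: FV.
    apply: (mulfI c0); move/eqP: e; rewrite addr_eq0 => /eqP ->.
    rewrite mulr_sumr -sumrN; apply: eq_bigr => i _.
    by rewrite !mulNr mulrN; congr (- _); rewrite mulrA mulrCA mulfV // mulr1.
  rewrite c00 mul0r add0r in e => i.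
  have {}ind := ind (fun i => c (lift ord0 i)) (fun i => hc _) e.
  by case: (unliftP ord0 i) => [j|] ->.
move=> x; rewrite inE => /orP[/eqP->|/span[c [hc ec]]].
  exists (fun i => if i == ord0 then 1 else 0); split; first by move=> i; case: ifP.
  by rewrite big_ord_recl /= mul1r big1 ?addr0 // => i _; rewrite mul0r.
exists (fun i => if unlift ord0 i is Some j then c j else 0); split.
  by move=> i; case: unliftP.
rewrite big_ord_recl unlift_none mul0r add0r ec.
by apply: eq_bigr => i _; rewrite liftK.
Qed.

End ExtractBasis.

(** * The decomposition group and the henselization *)

Section HenselizationField.
Variables (K : fieldType) (L : closedFieldType) (iota : {rmorphism K -> L}).
Variables (H : orderedAbGroupType) (w : L -> option H).
Hypothesis hw : is_valuation w.
Local Notation sepK := (sep_closure iota).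
Local Notation D := (decomposition_group iota w).
Local Notation Kh := (henselization iota w).

Lemma sep_closure_base c : sepK (iota c).
Proof.
apply/sep_closureP; exists ('X - c%:P).
  by have := separable_prod_XsubC [:: c]; rewrite big_seq1.
by rewrite rmorphB /= map_polyX map_polyC /= root_XsubC.
Qed.

Lemma aut_sep s x : D s -> sepK x -> sepK (s x).
Proof. by move=> [[[sS _ _] _ _ _] _] /sS. Qed.

Lemma autB s x y : D s -> sepK x -> sepK y -> s (x - y) = s x - s y.
Proof.
have [_ sB _] := sep_closure_subfield iota.
move=> [[_ sD _ _] _] sx sy; apply/eqP; rewrite -subr_eq0 opprB addrA.
by rewrite -sD ?subrK ?subrr //; exact: sB.
Qed.

Lemma autM s x y : D s -> sepK x -> sepK y -> s (x * y) = s x * s y.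
Proof. by move=> [[_ _ sM _] _]; exact: sM. Qed.

Lemma aut_base s c : D s -> s (iota c) = iota c.
Proof. by move=> [[_ _ _ sF] _]; apply: sF; exists c. Qed.

Lemma henselization_base c : Kh (iota c).
Proof. by split; [exact: sep_closure_base|move=> s; exact: aut_base]. Qed.

Lemma henselization_subfield : is_subfield Kh.
Proof.
have [s1 sB sV] := sep_closure_subfield iota.
split.
- by have := henselization_base 1; rewrite rmorph1.
- move=> x y [sx fx] [sy fy]; split; first exact: sB.
  by move=> s Ds; rewrite autB // fx // fy.
move=> x y [sx fx] [sy fy]; have sxy := sV _ _ sx sy; split => // s Ds.
have [->|y0] := eqVneq y 0.
  by rewrite invr0 mulr0 -(rmorph0 iota) aut_base.
apply: (mulIf y0); rewrite divfK //.
by have := autM Ds sxy sy; rewrite divfK // (fx s Ds) (fy s Ds) => <-.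
Qed.

Lemma decomposition_group_comp s t : D s -> D t -> D (s \o t).
Proof.
move=> Ds Dt; have [[sb _ _ _] sv] := Ds; have [[tb _ _ _] tv] := Dt.
split; last by move=> x sx /=; rewrite sv ?tv //; exact: aut_sep.
split; first exact: set_bij_comp tb sb.
- move=> x y sx sy /=.
  have [[_ tD _ _] _] := Dt; have [[_ sD _ _] _] := Ds.
  by rewrite tD // sD //; exact: aut_sep.
- by move=> x y sx sy /=; rewrite !autM //; exact: aut_sep.
by move=> _ [c _ <-] /=; rewrite !aut_base.
Qed.

Lemma decomposition_group_id : D id.
Proof.
by split => //; split => //; split => // y sy; exists y.
Qed.

(** An element s of the decomposition group is a ring morphism on the separable closure
    only, so map_poly s is not available and the coefficients are followed
    through the product by hand. *)
Lemma aut_coef_prod s (r : seq L) : D s -> (forall y, y \in r -> sepK y) ->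
  forall i, sepK (\prod_(y <- r) ('X - y%:P))`_i /\
    s (\prod_(y <- r) ('X - y%:P))`_i = (\prod_(y <- r) ('X - (s y)%:P))`_i.
Proof.
move=> Ds; have hS := sep_closure_subfield iota; have [_ sB _] := hS.
elim: r => [|y r IH] hr i.
  rewrite !big_nil coef1; case: (i == _).
    by rewrite mulr1n; split; [case: hS|rewrite -(rmorph1 iota) aut_base].
  by rewrite mulr0n; split; [exact: (subfield0 hS)|rewrite -(rmorph0 iota) aut_base].
have sy : sepK y by apply: hr; rewrite mem_head.
have {}IH : forall i, sepK (\prod_(y <- r) ('X - y%:P))`_i /\
    s (\prod_(y <- r) ('X - y%:P))`_i = (\prod_(y <- r) ('X - (s y)%:P))`_i.
  by apply: IH => u ur; apply: hr; rewrite inE ur orbT.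
rewrite !big_cons !mulrBl !coefB !coefXM !mul_polyC !coefZ.
have [si ei] := IH i; have syi := subfieldM hS sy si.
case: (i == 0)%N.
  split; first exact: (sB _ _ (subfield0 hS)).
  rewrite autB //; last exact: (subfield0 hS).
  by rewrite autM // ei -{1}(rmorph0 iota) aut_base // rmorph0.
have [si' ei'] := IH i.-1.
split; first exact: sB.
by rewrite autB // autM // ei ei'.
Qed.

(** The orbit of x consists of roots of the minimal polynomial of x, so it is finite, and the
    decomposition group permutes it. *)
Lemma orbit_polynomial x : sepK x -> exists G : {poly L},
  [/\ forall i, Kh G`_i, root G x
    & forall y, root G y -> exists2 s, D s & y = s x].
Proof.
move=> sx; have [p ps px] := (sep_closureP iota x).1 sx.
have p0 : p != 0 := separable_poly_neq0 ps.
have [r er] := closed_field_poly_normal (map_poly iota p).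
have rE y : (y \in r) = root (map_poly iota p) y.
  by rewrite er rootZ ?root_prod_XsubC // lead_coef_eq0 map_poly_eq0.
pose inO y := `[< exists2 s, D s & y = s x >].
pose O := [seq y <- undup r | inO y].
have O_r y : inO y -> y \in r.
  move=> /asboolP[s Ds ->]; rewrite rE.
  have hS := sep_closure_subfield iota.
  have ev Q : sepK (evalp iota x Q) /\ s (evalp iota x Q) = evalp iota (s x) Q.
    elim/poly_ind: Q => [|Q c [IH1 IH2]].
      by rewrite !rmorph0; split; [exact: (subfield0 hS)|rewrite -(rmorph0 iota) aut_base].
    rewrite !rmorphD !rmorphM !evalpC !evalpX.
    have sxQ := subfieldM hS IH1 sx.
    have sc := sep_closure_base c.
    have [_ sB _] := hS; split.
      by rewrite -[iota c]opprK; apply: (sB _ _ sxQ (subfieldN hS sc)).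
    by have [[_ sD _ _] _] := Ds; rewrite sD // autM // IH2 aut_base.
  rewrite evalp_root -(ev p).2 (eqP px : evalp iota x p = 0).
  by rewrite -(rmorph0 iota) aut_base.
have OE y : (y \in O) = inO y.
  rewrite mem_filter mem_undup andbC; case iy : (inO y); last by rewrite andbF.
  by rewrite O_r.
have Osep y : y \in O -> sepK y.
  by rewrite OE => /asboolP[s Ds ->]; exact: aut_sep.
exists (\prod_(y <- O) ('X - y%:P)); split.
- move=> i; split; first by have [] := aut_coef_prod decomposition_group_id Osep i.
  move=> s Ds; rewrite (aut_coef_prod Ds Osep i).2.
  rewrite -(big_map s xpredT (fun y => 'X - y%:P)).
  have s_inj : {in O &, injective s}.
    move=> y y' yO yO'; have [[[_ + _] _ _ _] _] := Ds; apply; rewrite inE; exact: Osep.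
  have uO : uniq O by rewrite filter_uniq ?undup_uniq.
  suff /(perm_big _) -> : perm_eq (map s O) O by [].
  have usO : uniq (map s O) by rewrite map_inj_in_uniq.
  have [] := uniq_min_size usO (s2 := O) _ _; rewrite ?size_map //.
    move=> _ /mapP[y yO ->]; rewrite OE; move: yO; rewrite OE => /asboolP[t Dt ->].
    by apply/asboolP; exists (s \o t) => //; exact: decomposition_group_comp.
  by move=> _ e; apply: uniq_perm.
- rewrite root_prod_XsubC OE; apply/asboolP; exists id => //.
  exact: decomposition_group_id.
by move=> y; rewrite root_prod_XsubC OE => /asboolP.
Qed.

End HenselizationField.

(** * Degrees over the henselization *)

Section Final.
Variables (K : fieldType) (L : closedFieldType) (iota : {rmorphism K -> L}).
Hypothesis hL : is_algebraic_closure iota.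
Variables (H : orderedAbGroupType) (w : L -> option H).
Hypothesis hw : is_valuation w.
Local Notation Kh := (henselization iota w).

(** With n a power of the characteristic exponent such that z^n is separable,
    G(X^n) vanishes at z for the orbit polynomial G of z^n.  It is thus a multiple
    of the minimal polynomial of z over K^h, which by assumption is f, and so
    y^n = s(z^n) for some s in the decomposition group.  As s fixes a^n, the
    elements (y - a)^n and (z - a)^n have the same value. *)
Lemma conjugates_equidistant a z f (F : fieldType) (j : {rmorphism F -> L}) (q : {poly F}) :
  Kh a -> range j = Kh -> root (map_poly iota f) z ->
  (forall Q, evalp j z Q = 0 -> q %| Q) ->
  map_poly j q = map_poly iota f ->
  forall y, root (map_poly iota f) y -> w (y - a) = w (z - a).
Proof.
move=> ha rj fz qmin qf y fy.
have [n pn sn] := sep_exponent (hL z).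
have n0 : (0 < n)%N by case: n pn {sn}.
have [G [GK Gx Groot]] := orbit_polynomial w sn.
have [G' eG] : exists G', map_poly j G' = G by apply: poly_over_range => i; rewrite rj.
have evG x : evalp j x (G' \Po 'X^n) = G.[x ^+ n].
  by rewrite evalpE map_comp_poly map_polyXn eG horner_comp hornerXn.
have /qmin qG : evalp j z (G' \Po 'X^n) = 0 by rewrite evG; exact/eqP.
have qy : root (map_poly j q) y by rewrite qf.
have /Groot[s Ds ys] : root G (y ^+ n).
  by rewrite rootE -evG (evalp_dvd qG qy).
have subX (x : L) : (x - a) ^+ n = x ^+ n - a ^+ n.
  by rewrite exprDn_pchar // exprNn_pchar.
have [san fan] := subfieldX n (henselization_subfield iota w) ha.
have e : w ((y - a) ^+ n) = w ((z - a) ^+ n).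
  rewrite !subX ys -{1}(fan s Ds) -(autB Ds) //; case: Ds => _; apply.
  by have [_ sB _] := sep_closure_subfield iota; exact: sB.
apply/weqP.
rewrite -(lev_Xe hw (y - a) (z - a) n0) -(lev_Xe hw (z - a) (y - a) n0).
by apply/weqP.
Qed.

(** Let d_i be the coefficients of q, and e_l a K-basis of their span, so that d_i is
    the sum of the k_il e_l.  From q(z) = 0 and the independence of the e_l
    over K(z), each polynomial with coefficients k_il vanishes at z.  If its
    degree is less than that of f, all k_il are 0, which contradicts that q is
    monic. *)
Lemma linearly_disjoint_degree_le z (f : {poly K}) (F : fieldType) (j : {rmorphism F -> L})
    (q : {poly F}) :
  (forall Q, evalp iota z Q = 0 -> f %| Q) ->
  q \is monic -> root (map_poly j q) z ->
  linearly_disjoint (range iota) (range j) (adjoin (range iota) z) ->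
  (size f <= size q)%N.
Proof.
move=> fmin qm qz dis; rewrite leqNgt; apply/negP => lt.
have hK0 := range_subfield iota.
pose d i := (map_poly j q)`_i.
have [es [sub ind span]] := extract_basis hK0 (map_poly j q).
have es_j i : (range j) (es`_i).
  have [le|lt'] := leqP (size es) i.
    by exists 0 => //; rewrite nth_default // raddf0.
  have /(nthP 0)[k _ <-] := sub _ (mem_nth 0 lt').
  by exists q`_k => //; rewrite coef_map.
have /choice[k hk] : forall i, exists k : 'I_(size es) -> K,
    d i = \sum_l iota (k l) * es`_l.
  move=> i; have [le|lt'] := leqP (size (map_poly j q)) i.
    exists (fun=> 0); rewrite /d nth_default // big1 // => l _.
    by rewrite rmorph0 mul0r.
  have [c [hc ec]] := span _ (mem_nth 0 lt').
  have /choice[k hk] : forall l, exists t, iota t = c l.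
    by move=> l; have [t _ e] := hc l; exists t.
  by exists k; rewrite /d ec; apply: eq_bigr => l _; rewrite hk.
pose Q l := \poly_(i < size q) k i l.
have Q0 l : Q l = 0.
  have h : evalp iota z (Q l) = 0.
    apply: (dis _ _ (fun i => es_j i) ind (fun l => evalp iota z (Q l)) _ _ l).
      by move=> l'; exact: evalp_adjoin.
    transitivity (\sum_(i < size q) d i * z ^+ i); last first.
      by move/rootP: qz; rewrite horner_coef size_map_poly => ->.
    under [RHS]eq_bigr => i _ do rewrite hk mulr_suml.
    rewrite exchange_big; apply: eq_bigr => l' _.
    rewrite /Q poly_def rmorph_sum mulr_suml; apply: eq_bigr => i _.
    by rewrite -mul_polyC rmorphM rmorphXn evalpC evalpX mulrAC.
  apply/eqP/negPn/negP => Ql; have := dvdp_leq Ql (fmin _ h).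
  by rewrite leqNgt (leq_ltn_trans (size_poly _ _)).
have : d (size q).-1 = 0.
  rewrite hk big1 // => l _.
  have := congr1 (fun P : {poly K} => P`_(size q).-1) (Q0 l).
  rewrite coef0 coef_poly prednK ?size_poly_gt0 ?monic_neq0 // leqnn => ->.
  by rewrite rmorph0 mul0r.
rewrite /d coef_map -lead_coefE (monicP qm) => /eqP.
by rewrite fmorph_eq0 oner_eq0.
Qed.

Theorem henselian_approximation z a : Kh a ->
  (forall c, a - iota c <v[w] z - a) ->
  [/\ ~ linearly_disjoint (range iota) Kh (adjoin (range iota) z),
      exists m n : nat,
        [/\ has_degree (adjoin Kh z) Kh m,
            has_degree (adjoin (range iota) z) (range iota) n & (m < n)%N]
    & ~ purely_inseparable_ext (adjoin (range iota) z) (range iota)].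
Proof.
move=> ha near.
have [F [j rj]] := subfield_type (henselization_subfield iota w).
have [f [fm fi fz fmin]] := minpoly_exists (hL z).
have [f' ef'] : exists f', map_poly j f' = map_poly iota f.
  apply: poly_over_range => i; rewrite rj coef_map; exact: henselization_base.
have f'z : root (map_poly j f') z by rewrite ef'.
have f'0 : f' != 0.
  by rewrite -(map_poly_eq0 j) ef' map_poly_eq0 monic_neq0.
have [q [qm qi qz qmin]] := minpoly_exists (ex_intro2 _ _ f' f'0 f'z).
have sf' : size f' = size f by rewrite -(size_map_poly j) ef' size_map_poly.
have f'm : f' \is monic.
  by rewrite -(map_monic j) ef' map_monic.
have qf' : q %| f' by apply: qmin; exact/eqP.
have lt : (size q < size f)%N.
  rewrite ltn_neqAle -sf' (dvdp_leq f'0 qf') andbT; apply/negP => sq.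
  have {}sq : q = f'.
    by apply/eqP; rewrite -eqp_monic // -dvdp_size_eqp.
  apply: (not_all_roots_near hL hw ha fm fi.1) => y fy c.
  have /weqP/andP[_ h] := conjugates_equidistant ha rj fz qmin (etrans (congr1 _ sq) ef') fy.
  exact: ltv_le_trans (near c) h.
split.
- rewrite -rj => /(linearly_disjoint_degree_le fmin qm qz); by rewrite leqNgt lt.
- exists (size q).-1, (size f).-1; split.
  + by rewrite -rj; exact: degree_adjoin.
  + exact: degree_adjoin.
  rewrite -ltnS !prednK // size_poly_gt0; exact: irredp_neq0.
move=> hpi; have [n pn [c _ zc]] : exists2 n : nat, [pchar L].-nat n & range iota (z ^+ n).
  by apply: hpi; have := @evalp_adjoin L K iota z 'X; rewrite evalpX.
have n0 : (0 < n)%N by case: n pn {zc}.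
have /fmin fd : evalp iota z ('X^n - c%:P) = 0.
  by rewrite rmorphB rmorphXn evalpX evalpC -zc subrr.
apply: (not_all_roots_near hL hw ha fm fi.1) => y fy c'.
suff -> : y = z by exact: near.
have := evalp_dvd fd fy; rewrite rmorphB rmorphXn evalpX evalpC zc => /eqP.
rewrite -exprNn_pchar // -exprDn_pchar // expf_eq0 n0 subr_eq0 /=.
by move/eqP.
Qed.

End Final.

Theorem theorem1p2
  (K : fieldType) (G : orderedAbGroupType) (v : K -> option G)
  (hv : is_valuation v)
  (L : closedFieldType) (iota : {rmorphism K -> L})
  (hL : is_algebraic_closure iota)
  (H : orderedAbGroupType) (w : L -> option H)
  (hw : is_valuation w) (hvw : extends_valuation iota v w)
  (z : L) (hz : ~ range iota z)
  (hza : exists2 a : L, henselization iota w a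
         & forall b, val_diffs w a (range iota) b -> vlt b (w (z - a))) :
  let K0 := range iota in
  let Kh := henselization iota w in
  [/\ ~ linearly_disjoint K0 Kh (adjoin K0 z),
      exists m n : nat,
        [/\ has_degree (adjoin Kh z) Kh m, has_degree (adjoin K0 z) K0 n
          & (m < n)%N]
    & ~ purely_inseparable_ext (adjoin K0 z) K0].
Proof.
move=> K0 Kh; have [a ha near] := hza.
apply: (henselian_approximation hL hw ha) => c.
by apply: near; exists (iota c) => //; exists c.
Qed.
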